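(* Let $d\in\mathbb N$ and let $\Delta=\langle p_1,p_2,p_3\rangle\subset\mathbb R^2$ be a nondegenerate triangle. Assume that at every interior vertex of the Wang–Shi split $\Delta_{WS_d}$ at most $d+1$ of the lines of the split intersect. Then $$\dim \mathbb S_d^{d-1}(\Delta_{WS_d})=\binom{d+2}{2}+3d(d-1),$$ where $3d(d-1)$ is the number of interior lines of the complete graph defining the split.
   Context: Wang–Shi split $WS_d$: divide each edge of $\Delta$ into $d$ equal segments, producing $3d$ boundary points (including the three vertices). Connect every pair of these $3d$ boundary points by a line segment (the complete graph on the boundary points); the resulting partition of $\Delta$ into polygons is denoted $\Delta_{WS_d}$, and its vertices are all intersection points of these segments (including the boundary points). The space $\mathbb S_d^{d-1}(\Delta_{WS_d})$ consists of all functions in $C^{d-1}(\Delta)$ whose restriction to each polygon of $\Delta_{WS_d}$ is a bivariate polynomial of total degree at most $d$. *)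

(* Defs.v *)
From HB Require Import structures.
From mathcomp Require Import all_boot all_order all_algebra.
From mathcomp Require Import all_classical all_reals all_analysis.
Import Order.TTheory GRing.Theory Num.Theory.
Import numFieldNormedType.Exports.

Set Implicit Arguments.
Unset Strict Implicit.
Unset Printing Implicit Defensive.

Local Open Scope classical_set_scope.
Local Open Scope ring_scope.

Section WS.
Variable R : realType.
Notation pt := (R * R)%type.

Definition triangle (p1 p2 p3 : pt) : set pt :=
  [set x | exists a b c : R, [/\ 0 <= a, 0 <= b, 0 <= c, a + b + c = 1 &
                              x = a *: p1 + b *: p2 + c *: p3]].

Definition nondegenerate_triangle (p1 p2 p3 : pt) : Prop :=
  (p2.1 - p1.1) * (p3.2 - p1.2) - (p2.2 - p1.2) * (p3.1 - p1.1) != 0.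

Definition tri_vtx (p1 p2 p3 : pt) (n : nat) : pt :=
  if (n %% 3 == 0)%N then p1 else if (n %% 3 == 1)%N then p2 else p3.

(* The 3d boundary points of the Wang--Shi split: point k (0 <= k < 3d)
   lies on edge e = k %/ d (from vertex e to vertex e+1, mod 3) at
   parameter (k %% d)/d.  Edge 0 = [p1,p2], edge 1 = [p2,p3], edge 2 = [p3,p1].
   The values k %% d = 0 give the three vertices. *)
Definition ws_point (p1 p2 p3 : pt) (d : nat) (k : 'I_(3 * d)) : pt :=
  let e := (k %/ d)%N in
  let P := tri_vtx p1 p2 p3 e in
  let Q := tri_vtx p1 p2 p3 e.+1 in
  P + ((k %% d)%:R / d%:R) *: (Q - P).

Definition segment (a b : pt) : set pt :=
  [set x | exists t : R, 0 <= t <= 1 /\ x = (1 - t) *: a + t *: b].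

Definition ws_union (p1 p2 p3 : pt) (d : nat) : set pt :=
  [set x | exists i j : 'I_(3 * d), i != j /\
           segment (ws_point p1 p2 p3 i) (ws_point p1 p2 p3 j) x].

Definition ws_polygons (p1 p2 p3 : pt) (d : nat) : set (set pt) :=
  let O := triangle p1 p2 p3 `\` ws_union p1 p2 p3 d in
  [set closure (connected_component O x) | x in O].

Definition ws_lines_through (p1 p2 p3 : pt) (d : nat) (x : pt) : nat :=
  #|[set ij : 'I_(3 * d) * 'I_(3 * d) | (nat_of_ord ij.1 < nat_of_ord ij.2)%N &&
       `[< segment (ws_point p1 p2 p3 ij.1) (ws_point p1 p2 p3 ij.2) x >] ]|.

Definition ws_interior_vertex (p1 p2 p3 : pt) (d : nat) (x : pt) : Prop :=
  interior (triangle p1 p2 p3) x /\ (2 <= ws_lines_through p1 p2 p3 d x)%N.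

Definition poly_le (d : nat) (g : pt -> R) : Prop :=
  exists c : nat -> nat -> R, forall x : pt,
    g x = \sum_(i < d.+1) \sum_(j < d.+1 | (i + j <= d)%N)
            c i j * x.1 ^+ i * x.2 ^+ j.

Definition coord_dir (b : bool) : pt := if b then (0, 1) else (1, 0).

Definition iterD (f : pt -> R) (s : seq bool) : pt -> R :=
  foldr (fun b g => 'D_(coord_dir b) g) f s.

Definition Cr_on (r : nat) (D : set pt) (f : pt -> R) : Prop :=
  [/\ {within D, continuous f},
      (forall (s : seq bool) (b : bool) (x : pt), (size s < r)%N ->
          interior D x -> derivable (iterD f s) x (coord_dir b)) &
      (forall s : seq bool, (size s <= r)%N ->
          exists h : pt -> R, {within D, continuous h} /\
            forall x, interior D x -> h x = iterD f s x)].

(* S_d^{d-1}(Delta_{WS_d}); functions on Delta are represented by their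
   extension by zero outside Delta. *)
Definition ws_spline_space (p1 p2 p3 : pt) (d : nat) : set (pt -> R) :=
  [set f | [/\ (forall x, ~ triangle p1 p2 p3 x -> f x = 0),
               Cr_on (d - 1) (triangle p1 p2 p3) f &
               forall P, ws_polygons p1 p2 p3 d P ->
                 exists g, poly_le d g /\ forall x, P x -> f x = g x]].

Definition has_dim (S : set (pt -> R)) (N : nat) : Prop :=
  exists b : 'I_N -> pt -> R,
    [/\ forall i, S (b i),
        (forall c : 'I_N -> R,
            (fun x => \sum_(i < N) c i * b i x) = (fun _ => 0) ->
            forall i, c i = 0) &
        forall f, S f -> exists c : 'I_N -> R,
            f = (fun x => \sum_(i < N) c i * b i x)].

End WS.

(* Main.v *)
(* Near every interior point x the spline f equals a polynomial plus a sum of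
   c_i max(0, l_i)^d over the lines l_i.  If a single line passes through x, this is
   because a C^(d-1) join of two polynomials of degree d across l is a multiple of
   l^d.  At a vertex, cut the neighbourhood by a generic line m through x: in each
   open half the lines do not meet, so the local representations glue there.
   Comparing the two halves across m on both sides of x gives a linear relation
   between the d-th powers of the at most d+1 lines through x; such powers are
   linearly independent, so the coefficients of the two halves agree.  Finally c_i is
   locally constant along l_i and the polynomial part is locally constant on the
   triangle, so by connectedness f is globally a polynomial plus a combination of
   the truncated powers of the 3d(d-1) interior lines; these functions are splines
   and are linearly independent. *)
Require Import Defs.
From HB Require Import structures.
From mathcomp Require Import all_boot all_order all_algebra.
From mathcomp Require Import all_classical all_reals all_analysis.
From mathcomp Require Import ring lra.
Import Order.TTheory GRing.Theory Num.Theory.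
Import numFieldNormedType.Exports.
Local Open Scope classical_set_scope.
Local Open Scope ring_scope.
Set Implicit Arguments.
Unset Strict Implicit.
Unset Printing Implicit Defensive.

(** * Polynomial functions and affine forms *)

Section PolyToolkit.
Variable R : realType.
Notation pt := (R * R)%type.
Implicit Types (l : R * R * R) (x y z v w : pt) (t : R).

(** The bound [d + 1] is the dimension of the space of binary forms of degree [d], and this is how
    many [d]-th powers of pairwise non-proportional linear forms can be independent. At a vertex the
    two comparison points on the generic line lie on opposite sides of [x], so each line through [x]
    is positive at exactly one of them. Subtracting the two relations therefore cancels the unknown
    polynomial, while every jump of a coefficient survives up to sign.

    Gluing rests on uniqueness: the coefficient of a line is determined by the germ of [f] at any
    point of that line. This holds even at a vertex, because the point can be slid along the line
    away from the other lines. The gluing takes place on convex sets, so that connectedness of a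
    segment is enough. The argument runs in the open triangle, described by positive barycentric
    coordinates, and continuity carries the result to the boundary. *)

Definition aff (l : R * R * R) (x : pt) : R := l.1.1 * x.1 + l.1.2 * x.2 + l.2.
Definition lin (l : R * R * R) (v : pt) : R := l.1.1 * v.1 + l.1.2 * v.2.
Definition ldet (l m : R * R * R) : R := l.1.1 * m.1.2 - l.1.2 * m.1.1.

Lemma aff_lin l x t v : aff l (x + t *: v) = aff l x + t * lin l v.
Proof. by rewrite /aff /lin /= /GRing.scale /=; ring. Qed.

Lemma eq_poly_le d (g h : pt -> R) : g =1 h -> poly_le d g -> poly_le d h.
Proof. by move=> gh [c gc]; exists c => x; rewrite -gh. Qed.

Lemma poly_le_mono d i j (k : R) : (i + j <= d)%N ->
  poly_le d (fun x : pt => k * x.1 ^+ i * x.2 ^+ j).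
Proof.
move=> ijd; exists (fun a b => if (a == i) && (b == j) then k else 0) => x.
have id : (i < d.+1)%N by rewrite ltnS (leq_trans _ ijd)// leq_addr.
have jd : (j < d.+1)%N by rewrite ltnS (leq_trans _ ijd)// leq_addl.
rewrite (bigD1 (Ordinal id))//= (bigD1 (Ordinal jd))//= !eqxx/=.
rewrite big1 ?addr0; last first.
  move=> b /andP[_ bj]; rewrite (_ : (_ == j) = false) ?mul0r//.
  by apply/negbTE; move: bj; apply: contra => /eqP bj; apply/eqP/val_inj.
rewrite big1 ?addr0// => a ai; apply: big1 => b _.
rewrite (_ : (_ == i) = false) ?mul0r//.
by apply/negbTE; move: ai; apply: contra => /eqP ai; apply/eqP/val_inj.
Qed.

Lemma poly_le_sum d (I : finType) (P : pred I) (g : I -> pt -> R) :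
  (forall i, poly_le d (g i)) -> poly_le d (fun x => \sum_(i | P i) g i x).
Proof.
move=> /choice[c gc]; exists (fun a b => \sum_(i | P i) c i a b) => x.
under eq_bigr do rewrite gc.
rewrite exchange_big/=; apply: eq_bigr => a _; rewrite exchange_big/=.
by apply: eq_bigr => b _; rewrite !mulr_suml.
Qed.

Lemma poly_leD d (g h : pt -> R) : poly_le d g -> poly_le d h ->
  poly_le d (fun x => g x + h x).
Proof.
move=> [a ga] [b hb]; exists (fun i j => a i j + b i j) => x.
rewrite ga hb -big_split/=; apply: eq_bigr => i _.
by rewrite -big_split/=; apply: eq_bigr => j _; rewrite !mulrDl.
Qed.

Lemma poly_leZ d k (g : pt -> R) : poly_le d g -> poly_le d (fun x => k * g x).
Proof.
move=> [a ga]; exists (fun i j => k * a i j) => x.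
rewrite ga mulr_sumr; apply: eq_bigr => i _.
by rewrite mulr_sumr; apply: eq_bigr => j _; rewrite !mulrA.
Qed.

Lemma poly_leB d (g h : pt -> R) : poly_le d g -> poly_le d h ->
  poly_le d (fun x => g x - h x).
Proof.
move=> pg ph; apply: (@eq_poly_le _ (fun x => g x + -1 * h x)) => [x|].
  by rewrite mulN1r.
exact/poly_leD/poly_leZ.
Qed.

Lemma poly_le0 d : poly_le d (fun _ : pt => 0 : R).
Proof.
by exists (fun _ _ => 0) => x; rewrite big1// => i _; rewrite big1// => j _; rewrite !mul0r.
Qed.

Lemma poly_le_affM d l (g : pt -> R) :
  poly_le d g -> poly_le d.+1 (fun x => aff l x * g x).
Proof.
move=> [c gc].
pose h x := \sum_(i < d.+1) \sum_(j < d.+1 | (i + j <= d)%N)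
   (l.1.1 * c i j * x.1 ^+ i.+1 * x.2 ^+ j +
    l.1.2 * c i j * x.1 ^+ i * x.2 ^+ j.+1 + l.2 * c i j * x.1 ^+ i * x.2 ^+ j).
apply: (@eq_poly_le _ h) => [x|].
  rewrite gc mulr_sumr; apply: eq_bigr => i _.
  rewrite mulr_sumr; apply: eq_bigr => j _.
  by rewrite /aff !exprS; ring.
apply: poly_le_sum => i.
pose T (j : 'I_d.+1) := if (i + j <= d)%N then 1 else 0 : R.
apply: (@eq_poly_le _ (fun x => \sum_(j < d.+1) T j *
   (l.1.1 * c i j * x.1 ^+ i.+1 * x.2 ^+ j +
    l.1.2 * c i j * x.1 ^+ i * x.2 ^+ j.+1 + l.2 * c i j * x.1 ^+ i * x.2 ^+ j))).
  move=> x; rewrite [RHS]big_mkcond/=; apply: eq_bigr => j _; rewrite /T.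
  by case: ifP; rewrite ?mul1r ?mul0r.
apply: poly_le_sum => j; rewrite /T; case: ifPn => [ijd|_]; last first.
  by apply: eq_poly_le (poly_le0 _) => x; rewrite mul0r.
apply/poly_leZ/poly_leD; last by apply: poly_le_mono; rewrite leqW.
by apply: poly_leD; apply: poly_le_mono; rewrite ?addSn ?addnS ltnS.
Qed.

Lemma poly_le_affX d l : poly_le d (fun x => aff l x ^+ d).
Proof.
elim: d => [|d IH]; last by apply: eq_poly_le (poly_le_affM l IH) => x; rewrite exprS.
by apply: eq_poly_le (@poly_le_mono 0 0 0 1 isT) => x; rewrite !expr0 !mulr1.
Qed.

(** [k] is the leading coefficient if the degree is exactly [n], and 0 if it is smaller; in this
    form it is multiplicative without a case split on degrees. *)
Definition coef_at (n : nat) (k : R) (p : {poly R}) := (size p <= n.+1)%N /\ p`_n = k.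

Lemma coef_atM m n a b p q : coef_at m a p -> coef_at n b q ->
  coef_at (m + n) (a * b) (p * q).
Proof.
move=> [sp pa] [sq qb]; split.
  rewrite (leq_trans (size_polyMleq _ _))//.
  by rewrite -subn1 leq_subLR add1n (leq_trans (leq_add sp sq))// addSn addnS.
have mn : (m < (m + n).+1)%N by rewrite ltnS leq_addr.
rewrite coefM (bigD1 (Ordinal mn))//= pa addKn qb big1 ?addr0// => i im.
have [mi|mi|mi] := ltngtP m i.
- by rewrite (nth_default _ (leq_trans sp mi)) mul0r.
- rewrite [q`_ _]nth_default ?mulr0// (leq_trans sq)// ltn_subRL.
  by rewrite ltn_add2r.
- by case/eqP: im; apply/val_inj.
Qed.

Lemma coef_atX n a p : coef_at 1 a p -> coef_at n (a ^+ n) (p ^+ n).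
Proof.
move=> pa; elim: n => [|n IH]; last by rewrite !exprS; exact: (coef_atM pa IH).
by split; rewrite ?size_poly1 ?coef1.
Qed.

Lemma coef_at_lin (a b : R) : coef_at 1 b (a%:P + b *: 'X).
Proof.
split; last by rewrite coefD coefC coefZ coefX mulr1 add0r.
rewrite (leq_trans (size_polyD _ _))// geq_max (leq_trans (size_polyC_leq1 _))//=.
by rewrite (leq_trans (size_scale_leq _ _))// size_polyX.
Qed.

(** The order of quantifiers carries the content: [k] is the value at [w] of the homogeneous part of
    degree [d] of [g], hence the same for all base points [z]. *)
Lemma poly_le_line d (g : pt -> R) w : poly_le d g ->
  exists k, forall z, exists p : {poly R},
    coef_at d k p /\ forall t, g (z + t *: w) = p.[t].
Proof.
move=> [c gc].
exists (\sum_(i < d.+1) \sum_(j < d.+1 | (i + j <= d)%N)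
  c i j * (if (i + j == d)%N then w.1 ^+ i * w.2 ^+ j else 0)) => z.
exists (\sum_(i < d.+1) \sum_(j < d.+1 | (i + j <= d)%N)
  c i j *: ((z.1%:P + w.1 *: 'X) ^+ i * (z.2%:P + w.2 *: 'X) ^+ j)).
split; last first.
  move=> t; rewrite gc horner_sum; apply: eq_bigr => i _.
  rewrite horner_sum; apply: eq_bigr => j _.
  rewrite hornerZ hornerM !horner_exp !hornerD !hornerC !hornerZ hornerX.
  by rewrite /= /GRing.scale/= mulrA (mulrC t) (mulrC t).
have H (i j : 'I_d.+1) : (i + j <= d)%N -> coef_at d
    (c i j * (if (i + j == d)%N then w.1 ^+ i * w.2 ^+ j else 0))
    (c i j *: ((z.1%:P + w.1 *: 'X) ^+ i * (z.2%:P + w.2 *: 'X) ^+ j)).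
  move=> ijd.
  have [s e] := coef_atM (coef_atX i (coef_at_lin z.1 w.1))
                         (coef_atX j (coef_at_lin z.2 w.2)).
  split; first by rewrite (leq_trans (size_scale_leq _ _))// (leq_trans s).
  rewrite coefZ; case: ifPn => [/eqP ije|ne]; first by rewrite -e ije.
  by rewrite nth_default// (leq_trans s)// ltn_neqAle ne.
split.
  rewrite (leq_trans (size_sum _ _ _))//; apply/bigmax_leqP => i _.
  rewrite (leq_trans (size_sum _ _ _))//; apply/bigmax_leqP => j ij.
  by have [] := H i j ij.
rewrite coef_sum; apply: eq_bigr => i _; rewrite coef_sum; apply: eq_bigr => j ij.
by have [] := H i j ij.
Qed.

Lemma poly_near_right0 (p : {poly R}) : (\forall t \near 0^'+, p.[t] = 0) -> p = 0.
Proof.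
move=> p0; apply/eqP; apply: contraT => pn0.
have [e /= e0 He] : nbhs 0^'+ [set t | p.[t] = 0] by [].
(* [size p] distinct roots are one too many; the denominators start at 2 to stay strictly below
   [e]. *)
pose s := [seq e / n.+2%:R | n <- iota 0 (size p)].
have := @max_poly_roots _ p s pn0 _ _.
rewrite size_map size_iota ltnn; apply.
- apply/allP => _ /mapP[n _ ->]; apply/eqP/He; last by rewrite divr_gt0.
  rewrite /= sub0r normrN gtr0_norm ?divr_gt0// ltr_pdivrMr// ltr_pMr//.
  by rewrite ltr1n.
- rewrite map_inj_uniq ?iota_uniq// => m n /(mulfI (lt0r_neq0 e0))/invr_inj/eqP.
  by rewrite eqr_nat => /eqP[].
Qed.

Lemma lineE x y : y = x + 1 *: (y - x).
Proof. by rewrite scale1r addrC subrK. Qed.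

Lemma cvg_line x v : x + t *: v @[t --> (0 : R)] --> x.
Proof.
rewrite -[X in _ --> X]addr0; apply: cvgD; first exact: cvg_cst.
by rewrite -[X in _ --> X](scale0r v); apply: cvgZr_tmp; exact: cvg_id.
Qed.

Lemma near_line x v (P : pt -> Prop) : (\forall y \near x, P y) ->
  \forall t \near 0^'+, P (x + t *: v).
Proof.
move=> xP; have : \forall t \near (0 : R), P (x + t *: v) by exact: (cvg_line v xP).
by apply: cvg_at_right_filter; exact: cvg_id.
Qed.

(** On the line from [x] to any [y], [g] is a polynomial in one variable that vanishes just to the
    right of 0. *)
Lemma poly_le_id d (g : pt -> R) x : poly_le d g ->
  (\forall y \near x, g y = 0) -> forall y, g y = 0.
Proof.
move=> pg g0 y; have [k /(_ x)[p [_ gp]]] := poly_le_line (y - x) pg.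
suff p0 : p = 0 by rewrite (lineE x y) gp p0 horner0.
apply: poly_near_right0.
by have := near_line (y - x) g0; apply: filterS => t; rewrite gp.
Qed.

(** The general-position choices below, of a direction or of a point on a line, are instances of
    this. *)
Lemma near_affine_neq0 (I : finType) (a b : I -> R) :
  (forall i, a i != 0 \/ b i != 0) ->
  \forall t \near 0^'+, forall i, a i + t * b i != 0.
Proof.
move=> ab; apply: filter_forall => i.
have [a0|a0] := eqVneq (a i) 0; last first.
- have : \forall t \near (0 : R), a i + t * b i != 0.
    have : a i + t * b i @[t --> (0 : R)] --> a i.
      rewrite -[X in _ --> X]addr0; apply: cvgD; first exact: cvg_cst.
      by rewrite -[X in _ --> X](mul0r (b i)); apply: cvgMr_tmp; exact: cvg_id.
    by move/cvgr_neq0; apply.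
  move=> H; apply: cvg_at_right_filter H; exact: cvg_id.
- have b0 : b i != 0 by case: (ab i) => //; rewrite a0 eqxx.
  rewrite a0; near=> t; rewrite add0r mulf_neq0//.
Unshelve. all: by end_near. Qed.

End PolyToolkit.

(** * Truncated powers and local representations *)

Section Splines.
Variable R : realType.
Notation pt := (R * R)%type.

Lemma aff_continuous (m : R * R * R) : continuous (aff m).
Proof.
move=> x; apply: cvgD; last exact: cvg_cst.
by apply: cvgD; apply: cvgM; (try exact: cvg_cst); [exact: cvg_fst|exact: cvg_snd].
Qed.

Definition has_sign (b : bool) (r : R) := if b then 0 < r else r < 0.

Lemma has_sign_gt0 (r : R) : r != 0 -> has_sign (0 < r) r.
Proof. by move=> r0; rewrite /has_sign; case: ltgtP r0 => //. Qed.

Lemma near_sign (m : R * R * R) b x : has_sign b (aff m x) ->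
  \forall y \near x, has_sign b (aff m y).
Proof.
case: b => /= m0.
  exact: (cvgr_gt _ (@aff_continuous m x)).
exact: (cvgr_lt _ (@aff_continuous m x)).
Qed.

Variables (d : nat) (d_gt0 : (0 < d)%N).

Definition tpow (m : R * R * R) (y : pt) : R := Num.max 0 (aff m y) ^+ d.

Lemma tpow_ge0 m y : 0 <= aff m y -> tpow m y = aff m y ^+ d.
Proof. by rewrite /tpow => m0; rewrite max_r. Qed.

Lemma tpow_le0 m y : aff m y <= 0 -> tpow m y = 0.
Proof. by rewrite /tpow => m0; rewrite max_l// expr0n -leqn0 leqNgt d_gt0. Qed.

Variables (L : finType) (l : L -> R * R * R).

Definition tpow_comb (c : L -> R) (y : pt) : R := \sum_i c i * tpow (l i) y.

Lemma tpow_combB c c' y : tpow_comb (fun i => c i - c' i) y = tpow_comb c y - tpow_comb c' y.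
Proof. by rewrite /tpow_comb -sumrB; apply: eq_bigr => i _; rewrite mulrBl. Qed.

(** Where [aff (l i)] keeps a weak sign, its truncated power is [aff (l i) y ^+ d] or 0, so a change
    of its coefficient only changes the polynomial part. *)
Lemma tpow_comb_absorb (A : set pt) c c' :
  (forall i, c i = c' i \/ (forall y, A y -> 0 <= aff (l i) y) \/
     (forall y, A y -> aff (l i) y <= 0)) ->
  exists q : pt -> R, poly_le d q /\ forall y, A y -> tpow_comb c y = q y + tpow_comb c' y.
Proof.
move=> H.
have /choice[q Hq] : forall i, exists q : pt -> R, poly_le d q /\
    forall y, A y -> (c i - c' i) * tpow (l i) y = q y.
  move=> i; case: (H i) => [->|[Ai|Ai]].
  - by exists (fun=> 0); split=> [|y _]; [exact: poly_le0|rewrite subrr mul0r].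
  - exists (fun y => (c i - c' i) * aff (l i) y ^+ d).
    by split=> [|y /Ai ?]; [exact/poly_leZ/poly_le_affX|rewrite tpow_ge0].
  - by exists (fun=> 0); split=> [|y /Ai ?]; [exact: poly_le0|rewrite tpow_le0// mulr0].
exists (fun y => \sum_i q i y); split.
  by apply: poly_le_sum => i; have [] := Hq i.
move=> y Ay; apply/eqP; rewrite -subr_eq -tpow_combB; apply/eqP/eq_bigr => i _.
by have [_ ->] := Hq i.
Qed.

(** [c] has an entry for every line, but only the entries of lines through [x] are meaningful: the
    others are arbitrary by [local_rep_irrel], these are unique by [local_rep_uniq]. *)
Definition local_rep (f : pt -> R) (c : L -> R) (x : pt) := exists q : pt -> R,
  poly_le d q /\ \forall y \near x, f y = q y + tpow_comb c y.

Lemma local_rep_near f c x : local_rep f c x -> \forall y \near x, local_rep f c y.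
Proof.
move=> [q [pq /near_join fq]]; near=> y; exists q; split => //.
by near: y.
Unshelve. all: by end_near. Qed.

Lemma near_signs x (J : pred L) : (forall i, J i -> aff (l i) x != 0) ->
  \forall y \near x, forall i, J i -> has_sign (0 < aff (l i) x) (aff (l i) y).
Proof.
move=> Jx; apply: (@filter_forall _ _ (fun i (y : pt) =>
  J i -> has_sign (0 < aff (l i) x) (aff (l i) y)) (nbhs x)) => i; have [/Jx ix|_] := boolP (J i).
  by have := near_sign (has_sign_gt0 ix); apply: filterS.
by near=> y.
Unshelve. all: by end_near. Qed.

Lemma local_rep_irrel f c c' x : (forall i, aff (l i) x = 0 -> c i = c' i) ->
  local_rep f c x -> local_rep f c' x.
Proof.
move=> cc' [q [pq fq]].
have near_x := @near_signs x (fun i => aff (l i) x != 0) (fun i => id).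
pose A : set pt := [set y | forall i, aff (l i) x != 0 ->
  has_sign (0 < aff (l i) x) (aff (l i) y)].
have [|p [pp Hp]] := @tpow_comb_absorb A c c'.
  move=> i; have [/cc' ->|ix] := eqVneq (aff (l i) x) 0; [by left|right].
  by case: (boolP (0 < aff (l i) x)) => [h|/negbTE h]; [left|right];
    move=> y /(_ i ix); rewrite h => /ltW.
exists (fun y => q y + p y); split; first exact: poly_leD.
near=> y; rewrite -addrA -Hp; last by near: y; exact: near_x.
by near: y.
Unshelve. all: by end_near. Qed.

(** For forms with non-zero gradient this says that distinct indices give distinct lines; parallel
    lines are allowed, since they have no common point [x]. *)
Definition lines_indep := forall i j (x : pt), i != j ->
  aff (l i) x = 0 -> aff (l j) x = 0 -> ldet (l i) (l j) != 0.
Definition lines_nondeg := forall i, (l i).1 != 0 :> pt.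

Definition dirv (m : R * R * R) : pt := (- m.1.2, m.1.1).

Lemma lin_dirv (m n : R * R * R) : lin n (dirv m) = - ldet n m.
Proof. by rewrite /lin /dirv /ldet /=; ring. Qed.

Lemma lin_grad (m : R * R * R) : m.1 != 0 -> 0 < lin m m.1.
Proof.
move=> m0; rewrite /lin lt_neqAle -!expr2 addr_ge0 ?sqr_ge0// andbT eq_sym.
rewrite paddr_eq0 ?sqr_ge0// !sqrf_eq0; apply: contra m0 => /andP[/eqP a /eqP b].
by rewrite [m.1]surjective_pairing a b.
Qed.

Hypothesis l_indep : lines_indep.
Hypothesis l_nondeg : lines_nondeg.

(** Near [z] all other truncated powers are polynomial. On the negative side of line [i] its own
    power vanishes, so the polynomial part vanishes along the normal through [z]; on the positive
    side only [c i] times a positive number remains. *)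
Lemma tpow_comb_coef0_simple q c i z : poly_le d q -> aff (l i) z = 0 ->
  (forall j, j != i -> aff (l j) z != 0) ->
  (\forall y \near z, q y + tpow_comb c y = 0) -> c i = 0.
Proof.
move=> pq iz jz qc.
have near_z := near_signs jz.
pose A : set pt := [set y | forall j, j != i ->
  has_sign (0 < aff (l j) z) (aff (l j) y)].
have [|p [pp Hp]] := @tpow_comb_absorb A c (fun j => if j == i then c i else 0).
  move=> j; have [->|ji] := eqVneq j i; [by left|right].
  by case: (boolP (0 < aff (l j) z)) => [h|/negbTE h]; [left|right];
    move=> y /(_ j ji); rewrite h => /ltW.
have SPi y : tpow_comb (fun j => if j == i then c i else 0) y = c i * tpow (l i) y.
  rewrite /tpow_comb (bigD1 i)//= eqxx big1 ?addr0// => j /negbTE ->.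
  by rewrite mul0r.
have g0 : \forall y \near z, (q y + p y) + c i * tpow (l i) y = 0.
  near=> y; rewrite -addrA -SPi -Hp; last by near: y; exact: near_z.
  by near: y.
have k0 := lin_grad (l_nondeg i).
have {}pq : poly_le d (fun y => q y + p y) by exact: poly_leD.
have [K /(_ z)[P [_ HP]]] := poly_le_line (- (l i).1) pq.
have P0 : P = 0.
  apply: poly_near_right0; near=> t.
  have : (q (z + t *: - (l i).1) + p (z + t *: - (l i).1)) +
      c i * tpow (l i) (z + t *: - (l i).1) = 0.
    by near: t; exact: (near_line _ g0).
  rewrite tpow_le0 ?mulr0 ?addr0 -?HP//.
  rewrite aff_lin iz add0r /lin /= !mulrN -opprD mulrN oppr_le0.
  by rewrite mulr_ge0// ltW.
suff [t] : exists t, 0 < t /\ (q (z + t *: (l i).1) + p (z + t *: (l i).1)) +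
      c i * tpow (l i) (z + t *: (l i).1) = 0.
  have -> : z + t *: (l i).1 = z + (- t) *: (- (l i).1) by rewrite scalerN scaleNr opprK.
  rewrite HP P0 horner0 add0r => -[t0 /eqP].
  rewrite scalerN scaleNr opprK mulf_eq0 => /orP[/eqP//|].
  rewrite tpow_ge0 aff_lin iz add0r ?mulr_ge0 ?ltW// expf_eq0 d_gt0/=.
  by rewrite mulf_eq0 !gt_eqF.
near ((0:R)^'+) => t; exists t; split; first by [].
by near: t; exact: (near_line _ g0).
Unshelve. all: by end_near. Qed.

(** The identity holds on a neighbourhood of [z], so [z] may be slid along line [i] to a point off
    all other lines. *)
Lemma tpow_comb_coef0 q c i z : poly_le d q -> aff (l i) z = 0 ->
  (\forall y \near z, q y + tpow_comb c y = 0) -> c i = 0.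
Proof.
move=> pq iz qc.
suff [t [jt qt]] : exists t,
    (forall j, (j != i) ==> (aff (l j) (z + t *: dirv (l i)) != 0)) /\
    \forall y \near z + t *: dirv (l i), q y + tpow_comb c y = 0.
  apply: tpow_comb_coef0_simple qt => [//||j ji].
    by rewrite aff_lin iz lin_dirv /ldet; ring.
  by have := jt j; rewrite ji.
(* The form of line [i] vanishes identically along its own direction; the dummy value 1 lets one
   application of [near_affine_neq0] cover all indices. *)
pose a j := if j == i then 1 else aff (l j) z.
have ab j : a j != 0 \/ lin (l j) (dirv (l i)) != 0.
  rewrite /a; have [|ji] := eqVneq j i; first by left; rewrite oner_eq0.
  have [jz|] := eqVneq (aff (l j) z) 0; [right|by left].
  by rewrite lin_dirv oppr_eq0; exact: l_indep jz iz.
near ((0:R)^'+) => t; exists t; split; last first.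
  near: t; exact: (near_line _ (P := fun x => \forall y \near x, q y + tpow_comb c y = 0)
    (near_join qc)).
move=> j; apply/implyP => ji; rewrite aff_lin.
suff /(_ j) : forall j, a j + t * lin (l j) (dirv (l i)) != 0.
  by rewrite /a (negbTE ji).
by near: t; exact: near_affine_neq0.
Unshelve. all: by end_near. Qed.

Lemma local_rep_uniq f c c' x i : aff (l i) x = 0 ->
  local_rep f c x -> local_rep f c' x -> c i = c' i.
Proof.
move=> ix [q [pq fq]] [q' [pq' fq']]; apply/eqP; rewrite -subr_eq0; apply/eqP.
apply: (@tpow_comb_coef0 (fun y => q y - q' y) (fun i => c i - c' i) i x) => //.
  exact: poly_leB.
near=> y; rewrite tpow_combB addrACA -opprD -(near fq y)// -(near fq' y)// subrr.
Unshelve. all: by end_near. Qed.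

Definition cvx (A : set pt) :=
  forall x y t, A x -> A y -> 0 <= t <= 1 -> A (x + t *: (y - x)).

Lemma segment_image_connected (x y : pt) :
  connected [set x + t *: (y - x) | t in `[0, 1]%classic].
Proof.
apply: connected_continuous_connected; first exact: segment_connected.
apply: continuous_subspaceT => t; apply: cvgD; first exact: cvg_cst.
by apply: cvgZr_tmp; exact: cvg_id.
Qed.

Lemma cvx_segment A (x y : pt) : cvx A -> A x -> A y ->
  [set x + t *: (y - x) | t in `[0, 1]%classic] `<=` A.
Proof. by move=> cA Ax Ay _ [t /= t01 <-]; apply: cA => //; rewrite in_itv in t01. Qed.

(** The points of the segment that satisfy [P] are open and closed in it. Neighbourhoods are
    relative to [A], which need not be open: it will also be the part of a line inside an open
    set. *)
Lemma cvx_locally_constant A (P : pt -> Prop) x y : cvx A ->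
  (forall z, A z -> \forall u \near z, A u -> (P z <-> P u)) ->
  A x -> A y -> P x -> P y.
Proof.
move=> cA loc Ax Ay Px.
set S := [set x + t *: (y - x) | t in `[0, 1]%classic].
have SA : S `<=` A by exact: cvx_segment.
suff SP : [set z | S z /\ P z] = S.
  have : S y by exists 1; rewrite /= ?in_itv/= ?ler01 ?lexx// -lineE.
  by rewrite -SP => -[].
apply: (@segment_image_connected x y).
- by exists x; split=> //; exists 0; rewrite /= ?in_itv/= ?ler01 ?lexx// scale0r addr0.
- exists [set z | A z -> P z]°; first exact: open_interior.
  rewrite seteqP; split=> z [Sz Pz]; split=> //.
    by have := loc _ (SA _ Sz); apply: filterS => u H /H <-.
  by have := interior_subset Pz; apply; exact: SA.
- exists (~` [set z | A z -> ~ P z]°); first exact/open_closedC/open_interior.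
  rewrite seteqP; split=> z [Sz Pz]; split=> //.
    by move=> /interior_subset/(_ (SA _ Sz)).
  apply: contrapT => nP; apply: Pz.
  by have := loc _ (SA _ Sz); apply: filterS => u H /H <-.
Qed.

Lemma cvx_setI A B : cvx A -> cvx B -> cvx (A `&` B).
Proof. by move=> cA cB x y t [? ?] [? ?] ?; split; [exact: cA|exact: cB]. Qed.

Lemma aff_seg m (x y : pt) t : aff m (x + t *: (y - x)) = (1 - t) * aff m x + t * aff m y.
Proof. by rewrite /aff /= /GRing.scale/=; ring. Qed.

Lemma cvx_aff0 m : cvx [set y | aff m y = 0].
Proof. by move=> x y t /= mx my _; rewrite aff_seg mx my !mulr0 addr0. Qed.

Lemma cvx_aff_sign m b : cvx [set y | has_sign b (aff m y)].
Proof.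
move=> x y t; rewrite /has_sign/= aff_seg => mx my /andP[t0 t1].
by case: b mx my => mx my; have [->|tn] := eqVneq t 0;
  rewrite ?subr0 ?mul1r ?mul0r ?addr0//; have {}t0 : 0 < t;
  rewrite ?lt_neqAle 1?eq_sym ?tn//; nra.
Qed.

Lemma local_rep_glob f U : cvx U -> open U -> (forall x, U x -> exists c, local_rep f c x) ->
  exists c (q : pt -> R), poly_le d q /\ forall x, U x -> f x = q x + tpow_comb c x.
Proof.
move=> cU oU locU.
have [[x0 Ux0]|U0] := pselect (exists x, U x); last first.
  exists (fun=> 0), (fun=> 0); split=> [|x Ux]; first exact: poly_le0.
  by case: U0; exists x.
have /choice[C HC] : forall i, exists k, forall x c,
    U x -> aff (l i) x = 0 -> local_rep f c x -> c i = k.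
  move=> i; have [[x [Ux ix]]|ne] := pselect (exists x, U x /\ aff (l i) x = 0); last first.
    (* A line that misses [U] gets the coefficient 0. *)
    by exists 0 => x c Ux ix; case: ne; exists x.
  have [c cx] := locU _ Ux; exists (c i) => y c' Uy iy c'y.
  pose A := U `&` [set y | aff (l i) y = 0].
  (* Quantifying over all representations at [z] avoids choosing one; by uniqueness a single one
     decides [P z]. *)
  pose P z := forall c', local_rep f c' z -> c' i = c i.
  suff Py : P y by exact: Py.
  apply: (@cvx_locally_constant A P x y) => //.
  - by apply: cvx_setI => //; exact: cvx_aff0.
  - move=> z [Uz iz]; have [e ez] := locU _ Uz.
    near=> u => -[Uu iu]; have eu : local_rep f e u by near: u; exact: local_rep_near.
    by split=> [Pz e' e'u|Pu e' e'z];
      [rewrite (local_rep_uniq iu e'u eu) Pz|rewrite (local_rep_uniq iz e'z ez) Pu].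
  - by move=> c1 c1x; apply: local_rep_uniq c1x cx.
(* All germs now share the coefficients [C]: those of lines through [x] already agree, the others
   may be replaced freely. *)
have LRC x : U x -> local_rep f C x.
  by move=> Ux; have [c cx] := locU _ Ux; apply: local_rep_irrel (cx) => i ix; apply: HC cx.
have [q [pq fq]] := LRC _ Ux0.
exists C, q; split => // x Ux.
pose P (z : pt) := \forall y \near z, f y = q y + tpow_comb C y.
suff : P x by move/nbhs_singleton.
apply: (@cvx_locally_constant U P x0 x) => // z Uz.
have [q' [pq' fq']] := LRC _ Uz.
near=> u => Uu.
have fq'u : \forall y \near u, f y = q' y + tpow_comb C y by near: u; exact: (near_join fq').
have aux (v : pt) : (\forall y \near v, f y = q' y + tpow_comb C y) -> P v -> q =1 q'.
  move=> H1 H2 y; apply/eqP; rewrite -subr_eq0; apply/eqP; move: y.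
  apply: (poly_le_id (poly_leB pq pq') (x := v)).
  near=> y; apply/eqP; rewrite subr_eq0; apply/eqP/(addIr (tpow_comb C y)).
  by rewrite -(near H1 y)// -(near H2 y).
split=> [/(aux _ fq') qq'|/(aux _ fq'u) qq'].
  by have := fq'u; apply: filterS => y ->; rewrite qq'.
by have := fq'; apply: filterS => y ->; rewrite qq'.
Unshelve. all: by end_near. Qed.

End Splines.

(** * Smooth joins across one line *)

Section Edge.
Variable R : realType.
Notation pt := (R * R)%type.

Lemma exprn_cvg n (g : pt -> R) (x : pt) : {for x, continuous g} ->
  {for x, continuous (fun y => g y ^+ n)}.
Proof. by move=> gx; apply: (cvg_comp _ (fun t => t ^+ n) gx); exact: exprn_continuous. Qed.

Lemma sum_continuous (I : finType) (P : pred I) (g : I -> pt -> R) :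
  (forall i, continuous (g i)) -> continuous (fun x => \sum_(i | P i) g i x).
Proof. by move=> gc; apply: continuous_big => [|i _]; [exact: add_continuous|exact: gc]. Qed.

Lemma poly_le_continuous d (g : pt -> R) : poly_le d g -> continuous g.
Proof.
move=> [c gc]; rewrite (_ : g = fun x : pt => \sum_(i < d.+1) \sum_(j < d.+1 | (i + j <= d)%N)
  c i j * x.1 ^+ i * x.2 ^+ j); last exact/funext.
apply: sum_continuous => i; apply: sum_continuous => j x.
apply: cvgM; first (apply: cvgM; first exact: cvg_cst).
  by apply: exprn_cvg; exact: cvg_fst.
by apply: exprn_cvg; exact: cvg_snd.
Qed.

Lemma tpow_continuous d (m : R * R * R) : continuous (tpow d m).
Proof.
move=> x; apply: exprn_cvg; apply: continuous_max; first exact: cvg_cst.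
exact: aff_continuous.
Qed.

Lemma tpow_comb_continuous d (L : finType) (l : L -> R * R * R) c : continuous (tpow_comb d l c).
Proof.
apply: sum_continuous => i x; apply: cvgM; first exact: cvg_cst.
exact: tpow_continuous.
Qed.

Lemma eq_lim_line (F G : pt -> R) z v : {for z, continuous F} -> {for z, continuous G} ->
  (\forall t \near 0^'+, F (z + t *: v) = G (z + t *: v)) -> F z = G z.
Proof.
move=> Fz Gz FG.
have zv : z + t *: v @[t --> 0^'+] --> z.
  by apply: cvg_at_right_filter; exact: cvg_line.
have Fc : F (z + t *: v) @[t --> 0^'+] --> F z by exact: (cvg_comp _ _ zv Fz).
have Gc : G (z + t *: v) @[t --> 0^'+] --> G z by exact: (cvg_comp _ _ zv Gz).
have Fc' : F (z + t *: v) @[t --> 0^'+] --> G z.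
  by apply: cvg_trans Gc; apply: near_eq_cvg; near=> t; apply/esym; near: t.
exact: cvg_unique Fc Fc'.
Unshelve. all: by end_near. Qed.

Lemma derive_line (F : pt -> R) z v (t : R) (P : {poly R}) :
  (\forall s \near t, F (z + s *: v) = P.[s]) -> 'D_v F (z + t *: v) = P^`().[t].
Proof.
move=> FP; rewrite derivE derive1E -(near_eq_derive _ FP) /derive.
set g1 := (fun _ : R => _); set g2 := (fun _ : R => _).
suff -> : g1 = g2 by [].
apply/funext => h; rewrite /g1 /g2 /=; congr (_ *: (F _ - _)).
by rewrite [h%:A]mulr1 scalerDl addrCA.
Qed.

(** Repeated derivatives in one direction only see the values of [F] on the line in that
    direction. *)
Lemma iterD_line (F : pt -> R) z b (t : R) (P : {poly R}) j :
  (\forall s \near t, F (z + s *: coord_dir R b) = P.[s]) ->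
  \forall s \near t, Defs.iterD F (nseq j b) (z + s *: coord_dir R b) = P^`(j).[s].
Proof.
elim: j => [//|j IH] /IH /near_join; apply: filterS => s Hs.
by rewrite /= (derive_line Hs).
Qed.

(** Data on one open ray suffice: there the derivatives are those of [P], and continuity at [z]
    carries them to the end point. The sign of [k] selects the ray. *)
Lemma iterD_limit (F : pt -> R) z b k (P : {poly R}) j : k != 0 ->
  {for z, continuous (Defs.iterD F (nseq j b))} ->
  (\forall t \near 0^'+, F (z + (k * t) *: coord_dir R b) = P.[k * t]) ->
  Defs.iterD F (nseq j b) z = P^`(j).[0].
Proof.
move=> k0 Fz [e /= e0 He].
have H : \forall t \near 0^'+,
    Defs.iterD F (nseq j b) (z + t *: (k *: coord_dir R b)) = P^`(j).[k * t].
  near=> t; rewrite scalerA mulrC.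
  suff /nbhs_singleton : \forall s \near k * t,
    Defs.iterD F (nseq j b) (z + s *: coord_dir R b) = P^`(j).[s] by [].
  apply: iterD_line.
  have t0e : t \in `]0, e[.
    by rewrite in_itv/=; apply/andP; split; near: t;
      [exact: nbhs_right_gt|exact: nbhs_right_lt].
  have : \forall s \near k * t, k^-1 * s \in `]0, e[.
    have : k^-1 * s @[s --> k * t] --> t.
      rewrite -[X in _ --> X](mulKf k0); apply: cvgM; first exact: cvg_cst.
      exact: cvg_id.
    by move/(_ _ (near_in_itvoo t0e)).
  apply: filterS => s; rewrite in_itv/= => /andP[s0 se].
  have := He (k^-1 * s); rewrite /= mulVKf//; apply => //.
  by rewrite sub0r normrN gtr0_norm.
have zv : z + t *: (k *: coord_dir R b) @[t --> 0^'+] --> z.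
  by apply: cvg_at_right_filter; exact: cvg_line.
have Fc : Defs.iterD F (nseq j b) (z + t *: (k *: coord_dir R b)) @[t --> 0^'+]
   --> Defs.iterD F (nseq j b) z by exact: (cvg_comp _ _ zv Fz).
have Pc : P^`(j).[k * t] @[t --> 0^'+] --> P^`(j).[0].
  apply: cvg_at_right_filter; rewrite -[in X in _ --> X](mulr0 k).
  apply: (cvg_comp (fun t : R => k * t) (horner P^`(j))); last exact: continuous_horner.
  by apply: cvgM; [exact: cvg_cst|exact: cvg_id].
have Fc' : Defs.iterD F (nseq j b) (z + t *: (k *: coord_dir R b)) @[t --> 0^'+] --> P^`(j).[0].
  by apply: cvg_trans Pc; apply: near_eq_cvg; near=> t; apply/esym; near: t.
exact: cvg_unique Fc Fc'.
Unshelve. all: by end_near. Qed.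

Lemma poly_top d (P : {poly R}) k : coef_at d k P ->
  (forall j, (j < d)%N -> P^`(j).[0] = 0) -> forall t, P.[t] = k * t ^+ d.
Proof.
move=> [sP <-] P0 t; rewrite (horner_coef_wide _ sP) big_ord_recr/= big1 ?add0r// => i _.
have := P0 i (ltn_ord i); rewrite horner_coef0 coef_derivn addn0 ffactnn => /eqP.
by rewrite mulrn_eq0 -leqn0 leqNgt fact_gt0/= => /eqP ->; rewrite mul0r.
Qed.

(** On both rays the derivatives of order below [d] tend to those of [F] at [z], so [P1] and [P2]
    differ at most in the term of degree [d]. *)
Lemma iterD_join (F : pt -> R) z b k d (P1 P2 : {poly R}) k1 k2 : k != 0 -> (0 < d)%N ->
  coef_at d k1 P1 -> coef_at d k2 P2 ->
  (forall j, (j < d)%N -> {for z, continuous (Defs.iterD F (nseq j b))}) ->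
  (\forall t \near 0^'+, F (z + (k * t) *: coord_dir R b) = P1.[k * t]) ->
  (\forall t \near 0^'+, F (z + (- k * t) *: coord_dir R b) = P2.[- k * t]) ->
  F z = P2.[0] /\ forall t, P1.[t] = P2.[t] + (k1 - k2) * t ^+ d.
Proof.
move=> k0 d0 [s1 e1] [s2 e2] Fc H1 H2; split.
  by have := iterD_limit (j := 0) _ (Fc _ d0) H2; rewrite oppr_eq0 => /(_ k0).
move=> t; apply/eqP; rewrite addrC -subr_eq -hornerN -hornerD; apply/eqP.
apply: poly_top.
  split; last by rewrite coefB e1 e2.
  by rewrite (leq_trans (size_polyD _ _))// geq_max s1 size_polyN.
move=> j jd; rewrite derivnB hornerD hornerN.
rewrite -(iterD_limit k0 (Fc _ jd) H1) -(iterD_limit _ (Fc _ jd) H2) ?subrr//.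
by rewrite oppr_eq0.
Qed.

Variables (d : nat) (d_gt0 : (0 < d)%N) (L : finType) (l : L -> R * R * R).
Hypothesis l_nondeg : lines_nondeg l.
Variables (f : pt -> R) (U : set pt) (oU : open U).
Hypothesis f_smooth : forall b j x, (j < d)%N -> U x ->
  {for x, continuous (Defs.iterD f (nseq j b))}.
(** A sign vector [s] names a cell of the arrangement; for an empty cell the condition is
    vacuous. *)
Hypothesis f_pw : forall s : L -> bool, exists q : pt -> R, poly_le d q /\
  forall y, U y -> (forall i, has_sign (s i) (aff (l i) y)) -> f y = q y.

Lemma near_piece x : U x -> (forall i, aff (l i) x != 0) ->
  exists q : pt -> R, poly_le d q /\ \forall y \near x, f y = q y.
Proof.
move=> Ux ix; have [q [pq fq]] := f_pw (fun i => 0 < aff (l i) x).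
exists q; split => //.
have near_x := @near_signs _ _ l x xpredT (fun i _ => ix i).
near=> y; apply: fq; first by near: y; exact: open_nbhs_nbhs.
move=> i; suff /(_ i isT) : forall i, xpredT i ->
  has_sign (0 < aff (l i) x) (aff (l i) y) by [].
by near: y.
Unshelve. all: by end_near. Qed.

Lemma coord_transversal (m : R * R * R) : m.1 != 0 -> exists b, lin m (coord_dir R b) != 0.
Proof.
rewrite /lin /coord_dir => m0; have [m1|m1] := eqVneq m.1.1 0; last first.
  by exists false; rewrite /= mulr1 mulr0 addr0.
exists true; rewrite /= mulr1 mulr0 add0r; apply: contra m0 => /eqP m2.
by rewrite [m.1]surjective_pairing m1 m2.
Qed.

(* Derivatives along a single coordinate direction transversal to the line suffice:
   they force the jump to be k t^d along that direction, and k is the top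
   coefficient, which does not depend on the base point. *)
Lemma local_rep_edge x : U x -> (forall i j, aff (l i) x = 0 -> aff (l j) x = 0 -> i = j) ->
  exists c, local_rep d l f c x.
Proof.
move=> Ux one.
have [[i ix]|none] := pselect (exists i, aff (l i) x = 0); last first.
  have [|q [pq fq]] := near_piece Ux.
    by move=> i; apply/eqP => ix; apply: none; exists i.
  exists (fun=> 0), q; split=> //; near=> y.
  rewrite /tpow_comb big1 ?addr0; first by near: y.
  by move=> j _; rewrite mul0r.
have jx j : j != i -> aff (l j) x != 0.
  by move=> ji; apply: contra ji => /eqP jx; apply/eqP/one.
(* The two cells that meet along line [i] at [x]. *)
pose s b j := if j == i then b else 0 < aff (l j) x.
have [q1 [pq1 fq1]] := f_pw (s true).
have [q2 [pq2 fq2]] := f_pw (s false).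
have [b kb] := coord_transversal (l_nondeg i).
set k := lin _ _ in kb; set e := coord_dir R b in k kb.
have [k1 HP1] := poly_le_line e pq1; have [k2 HP2] := poly_le_line e pq2.
pose good y := U y /\ forall j, j != i -> has_sign (0 < aff (l j) x) (aff (l j) y).
have good_x : \forall y \near x, good y.
  by apply: filterI; [exact: open_nbhs_nbhs|exact: near_signs].
have good1 y : good y -> 0 < aff (l i) y -> f y = q1 y.
  move=> [Uy jy] iy; apply: fq1 => // j; rewrite /s.
  by have [->|/jy] := eqVneq j i.
have good2 y : good y -> aff (l i) y < 0 -> f y = q2 y.
  move=> [Uy jy] iy; apply: fq2 => // j; rewrite /s.
  by have [->|/jy] := eqVneq j i.
have kk0 : 0 < k * k by rewrite -expr2 lt_neqAle sqr_ge0 eq_sym sqrf_eq0 kb.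
have join : \forall z \near x, aff (l i) z = 0 -> f z = q2 z /\
    forall t, q1 (z + t *: e) = q2 (z + t *: e) + (k1 - k2) * t ^+ d.
  near=> z => iz.
  have good_z : \forall y \near z, good y by near: z; exact: (near_join good_x).
  have Uz : U z by have [] := nbhs_singleton good_z.
  have [P1 [cP1 hP1]] := HP1 z; have [P2 [cP2 hP2]] := HP2 z.
  have [] := @iterD_join f z b k d P1 P2 k1 k2 kb d_gt0 cP1 cP2.
  - by move=> j jd; exact: f_smooth.
  - near=> t; rewrite -hP1; apply: good1.
      by rewrite mulrC -scalerA; near: t; exact: (near_line _ good_z).
    by rewrite aff_lin iz add0r -/k mulrAC pmulr_rgt0.
  - near=> t; rewrite -hP2; apply: good2.
      by rewrite mulrC -scalerA; near: t; exact: (near_line _ good_z).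
    by rewrite aff_lin iz add0r -/k mulrAC mulNr mulNr oppr_lt0 pmulr_rgt0.
  - by rewrite -hP2 scale0r addr0 => -> H; split=> // t; rewrite hP1 hP2.
(* Moving by [t *: e] off the line gives the form the value [k * t]; division by [k ^+ d] turns the
   jump [(k1 - k2) * t ^+ d] into a multiple of the [d]-th power of the form. *)
exists (fun j => if j == i then (k1 - k2) / k ^+ d else 0), q2; split=> //.
(* Projection onto line [i] along [e]. It is continuous and fixes [x], so the join identity is
   available at [pr y] for [y] near [x]. *)
pose pr (y : pt) := y - (aff (l i) y / k) *: e.
have prx : pr y @[y --> x] --> pr x.
  apply: cvgB; first exact: cvg_id.
  apply: cvgZr_tmp; apply: cvgM; last exact: cvg_cst.
  exact: aff_continuous.
rewrite {2}/pr ix mul0r scale0r subr0 in prx.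
have joinpr := prx _ join.
near=> y.
have good_y : good y by near: y.
rewrite /tpow_comb (bigD1 i)//= eqxx big1 ?addr0; last by move=> j /negbTE ->; rewrite mul0r.
have pr0 : aff (l i) (pr y) = 0.
  by rewrite /pr -scaleNr aff_lin -/k mulNr divfK// subrr.
have [] : f (pr y) = q2 (pr y) /\
    forall t, q1 (pr y + t *: e) = q2 (pr y + t *: e) + (k1 - k2) * t ^+ d.
  suff : aff (l i) (pr y) = 0 -> f (pr y) = q2 (pr y) /\
    forall t, q1 (pr y + t *: e) = q2 (pr y + t *: e) + (k1 - k2) * t ^+ d by apply.
  by near: y.
move=> fpr /(_ (aff (l i) y / k)); rewrite subrK => q12.
have [iy|iy|iy] := ltgtP 0 (aff (l i) y).
- by rewrite tpow_ge0 ?ltW// good1// q12 expr_div_n mulrA mulrAC.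
- by rewrite tpow_le0 ?ltW// mulr0 addr0 good2.
- rewrite tpow_le0 -?iy// mulr0 addr0.
  by move: fpr; rewrite /pr -iy mul0r scale0r subr0.
Unshelve. all: by end_near. Qed.

End Edge.

(** * Representation around a vertex *)

Section Vertex.
Variable R : realType.
Notation pt := (R * R)%type.

Lemma ldet_lin0 (m n : R * R * R) (v : pt) :
  ldet m n != 0 -> lin m v = 0 -> lin n v = 0 -> v = 0.
Proof.
move=> det0 mv nv.
have v1 : ldet m n * v.1 = 0.
  rewrite (_ : _ * _ = n.1.2 * lin m v - m.1.2 * lin n v); last by rewrite /ldet /lin; ring.
  by rewrite mv nv !mulr0 subr0.
have v2 : ldet m n * v.2 = 0.
  rewrite (_ : _ * _ = m.1.1 * lin n v - n.1.1 * lin m v); last by rewrite /ldet /lin; ring.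
  by rewrite mv nv !mulr0 subr0.
by move/eqP: v1; move/eqP: v2; rewrite [v]surjective_pairing !mulf_eq0 (negbTE det0)/=
  => /eqP -> /eqP ->.
Qed.

Lemma linDZ (m : R * R * R) (u v : pt) t : lin m (u + t *: v) = lin m u + t * lin m v.
Proof. by rewrite /lin /= /GRing.scale/=; ring. Qed.

Lemma linZ (m : R * R * R) t (v : pt) : lin m (t *: v) = t * lin m v.
Proof. by rewrite /lin /= /GRing.scale/=; ring. Qed.

Variables (d : nat) (d_gt0 : (0 < d)%N) (L : finType) (l : L -> R * R * R).
Hypothesis l_nondeg : lines_nondeg l.
Hypothesis l_indep : lines_indep l.

Lemma generic_line (x : pt) : exists m : R * R * R,
  [/\ m.1 != 0, aff m x = 0 & forall i, ldet (l i) m != 0].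
Proof.
suff [t Ht] : exists t, forall i, - (l i).1.2 + t * (l i).1.1 != 0.
  exists (1, t, - (x.1 + t * x.2)); split => /=.
  - by rewrite -[_ == _]/((_ == 0) && (_ == 0)) oner_eq0.
  - by rewrite /aff /=; ring.
  - by move=> i; rewrite /ldet /= mulr1 addrC mulrC.
near ((0 : R)^'+) => t; exists t; near: t; apply: near_affine_neq0 => i.
rewrite oppr_eq0; have := l_nondeg i; rewrite [(l i).1]surjective_pairing.
have [->|] := eqVneq (l i).1.1 0; last by right.
have [->|] := eqVneq (l i).1.2 0; last by left.
by rewrite eqxx.
Unshelve. all: by end_near. Qed.

(** On the line [x + u + t *: w] the forms become [q i * (r i + t)] with distinct [r i]. Comparing
    powers of [t] makes the moments of the weights [b i] vanish up to order [d]. A polynomial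
    vanishing at all nodes except [r i0] then isolates [a i0]; its degree is at most [d] because [I]
    has at most [d + 1] elements. *)
Lemma pows_indep x (I : {set L}) (a : L -> R) :
  (forall i, i \in I -> aff (l i) x = 0) -> (#|I| <= d.+1)%N ->
  (forall i, i \notin I -> a i = 0) ->
  (forall y, \sum_i a i * aff (l i) y ^+ d = 0) -> forall i, a i = 0.
Proof.
move=> Ix cI aI suma i0.
have [iI|] := boolP (i0 \in I); last exact: aI.
have [m [m0 _ lm]] := generic_line x.
pose u : pt := m.1; pose w := dirv m.
pose p i := lin (l i) u; pose q i := lin (l i) w.
have q0 i : q i != 0 by rewrite /q /w lin_dirv oppr_eq0.
pose r i := p i / q i.
(* Equal ratios would make two independent forms kill [u - r i *: w], forcing it to be 0; but
   [lin m] takes on it the same positive value as on the normal [u]. *)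
have r_inj i j : i \in I -> j \in I -> r i = r j -> i = j.
  move=> /Ix ix /Ix jx rij; apply/eqP; apply: contraT => ij.
  have lr k : lin (l k) (u - r k *: w) = 0.
    by rewrite -scaleNr linDZ mulNr -/(q k) divfK// subrr.
  have uw : u - r i *: w = 0.
    by apply: (ldet_lin0 (l_indep ij ix jx)) => //; rewrite rij.
  have := lin_grad m0; rewrite (_ : lin m m.1 = lin m (u - r i *: w)).
    by rewrite uw /lin/= !mulr0 addr0 ltxx.
  by rewrite -scaleNr linDZ lin_dirv /u /ldet; ring.
pose b i := a i * q i ^+ d.
have sumb t : \sum_i b i * (r i + t) ^+ d = 0.
  rewrite -[RHS](suma (x + u + t *: w)); apply: eq_bigr => i _.
  have [/Ix ix|/aI ai] := boolP (i \in I); last by rewrite /b ai !mul0r.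
  rewrite aff_lin -[u]scale1r aff_lin ix add0r mul1r -/(p i) -/(q i) /b -mulrA -exprMn.
  by congr (_ * _ ^+ _); rewrite mulrDr mulrC divfK// (mulrC t).
have mom k : (k <= d)%N -> \sum_i b i * r i ^+ k = 0.
  (* This is the previous sum expanded in [t]; its coefficient of index [d - k] is the [k]-th moment
     times a non-zero binomial coefficient. *)
  pose P := \poly_(j < d.+1) (\sum_i b i * r i ^+ (d - j) *+ 'C(d, j)).
  have P0 : P = 0.
    apply: poly_near_right0; near=> t.
    rewrite horner_poly -[RHS](sumb t).
    under [RHS]eq_bigr do rewrite exprDn mulr_sumr.
    rewrite exchange_big/=; apply: eq_bigr => j _.
    by rewrite mulr_suml; apply: eq_bigr => i _; rewrite mulrnAr mulrnAl mulrA.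
  move=> kd; have : P`_(d - k) = 0 by rewrite P0 coef0.
  rewrite coef_poly ltnS leq_subr subKn// sumrMnl => /eqP.
  rewrite mulrn_eq0 => /orP[|/eqP//].
  by rewrite -leqn0 leqNgt bin_gt0 leq_subr.
pose Q := \prod_(j in I :\ i0) ('X - (r j)%:P).
have sQ : (size Q <= d.+1)%N.
  rewrite /Q -big_enum/= size_prod_XsubC -cardE.
  by move: cI; rewrite (cardsD1 i0) iI add1n.
have : \sum_i b i * Q.[r i] = 0.
  under eq_bigr do rewrite (horner_coef_wide _ sQ) mulr_sumr.
  rewrite exchange_big/= big1// => k _.
  under eq_bigr do rewrite mulrCA.
  by rewrite -mulr_sumr mom ?mulr0// -ltnS.
rewrite (bigD1 i0)//= [X in _ + X]big1 ?addr0.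
  move/eqP; rewrite mulf_eq0 /b mulf_eq0 expf_eq0 (negbTE (q0 _)) andbF orbF.
  case/orP=> [/eqP//|]; rewrite horner_prod prodf_seq_eq0 => /hasP[j _].
  rewrite !inE hornerXsubC subr_eq0 => /andP[/andP[ji jI] /eqP rr].
  by move: ji; rewrite (r_inj _ _ jI iI) ?eqxx.
move=> i ii0; have [iI'|/aI ai] := boolP (i \in I); last by rewrite /b ai !mul0r.
rewrite horner_prod (bigD1 i)/=; last by rewrite !inE ii0.
by rewrite hornerXsubC subrr mul0r mulr0.
Unshelve. all: by end_near. Qed.

Variables (f : pt -> R) (U : set pt) (oU : open U) (cU : cvx U).
Hypothesis f_smooth : forall b j x, (j < d)%N -> U x ->
  {for x, continuous (Defs.iterD f (nseq j b))}.
Hypothesis f_pw : forall s : L -> bool, exists q : pt -> R, poly_le d q /\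
  forall y, U y -> (forall i, has_sign (s i) (aff (l i) y)) -> f y = q y.

(** No line that misses [x] separates these points from [x], so only lines through [x] can meet this
    neighbourhood. *)
Definition star (x : pt) : set pt := U `&`
  [set y | forall i, aff (l i) x != 0 -> has_sign (0 < aff (l i) x) (aff (l i) y)].

Lemma cvx_star x : cvx (star x).
Proof.
apply: cvx_setI => // y z t Hy Hz t01 i ix.
exact: (cvx_aff_sign (Hy i ix) (Hz i ix)).
Qed.

Lemma open_star x : open (star x).
Proof.
apply: openI => //; rewrite openE => y Hy.
have near_y := @near_signs _ _ l y (fun i => aff (l i) x != 0).
have sgE i : aff (l i) x != 0 -> (0 < aff (l i) y) = (0 < aff (l i) x).
  by move=> /Hy; rewrite /has_sign; case: ifP => // _ /ltW; rewrite ltNge => ->.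
have : \forall z \near y, forall i, aff (l i) x != 0 ->
    has_sign (0 < aff (l i) y) (aff (l i) z).
  apply: near_y => i /Hy; rewrite /has_sign.
  by case: ifP => _; [exact: lt0r_neq0|exact: ltr0_neq0].
by apply: filterS => z Hz i ix; rewrite -(sgE i ix); exact: Hz.
Qed.

Lemma star_self x : U x -> star x x.
Proof. by move=> Ux; split => // i; exact: has_sign_gt0. Qed.

Lemma star_zero x y i : star x y -> aff (l i) y = 0 -> aff (l i) x = 0.
Proof.
move=> [_ H] iy; apply/eqP; apply: contraT => /H; rewrite iy /has_sign ltxx.
by case: ifP.
Qed.

(* Inside an open half-plane bounded by a line through [x], no two lines of the
   star of [x] meet. *)
Lemma half_rep x m : U x -> aff m x = 0 -> exists c (q : pt -> R),
  [/\ poly_le d q, forall i, aff (l i) x != 0 -> c i = 0 &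
      forall y, star x y -> 0 < aff m y -> f y = q y + tpow_comb d l c y].
Proof.
move=> Ux mx; pose H := star x `&` [set y | has_sign true (aff m y)].
have cH : cvx H by apply: cvx_setI; [exact: cvx_star|exact: cvx_aff_sign].
have oH : open H.
  apply: openI; first exact: open_star.
  by rewrite openE => y; exact: near_sign.
have [|c [q [pq fq]]] := local_rep_glob d_gt0 l_indep l_nondeg (f := f) cH oH.
  move=> y [sy my]; apply: (local_rep_edge d_gt0 l_nondeg oU f_smooth f_pw).
    by case: sy.
  (* Two lines that meet at [y] in the star both pass through [x], hence [y = x], against
     [0 < aff m y]. *)
  move=> i j iy jy; apply/eqP; apply: contraT => ij.
  have ix := star_zero sy iy; have jx := star_zero sy jy.
  have yx k : aff (l k) x = 0 -> aff (l k) y = 0 -> lin (l k) (y - x) = 0.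
    by move=> kx; have := aff_lin (l k) x 1 (y - x); rewrite -lineE kx add0r mul1r => <-.
  have yx0 : y - x = 0 by apply: (ldet_lin0 (l_indep ij ix jx)); apply: yx.
  have := aff_lin m x 1 (y - x); rewrite -lineE mx add0r mul1r yx0 /lin !mulr0 addr0 => my0.
  by move: my; rewrite /= my0 ltxx.
have [|r [pr Hr]] := @tpow_comb_absorb _ _ d_gt0 _ l (star x) c
    (fun i => if aff (l i) x == 0 then c i else 0).
  move=> i; have [_|ix] := eqVneq (aff (l i) x) 0; [by left|right].
  by case: (boolP (0 < aff (l i) x)) => [h|/negbTE h]; [left|right];
    move=> y [_ /(_ i ix)]; rewrite h => /ltW.
exists (fun i => if aff (l i) x == 0 then c i else 0), (fun y => q y + r y); split.
- exact: poly_leD.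
- by move=> i /negbTE ->.
- by move=> y sy my; rewrite fq// Hr// addrA.
Qed.

(** Off all lines, [f] and the proposed representation are both polynomial near [a]. They agree on
    the part where [aff m] is positive, which is open and comes arbitrarily close to [a], hence they
    agree on both sides. *)
Lemma half_extend x m c (q : pt -> R) a : poly_le d q -> m.1 != 0 ->
  (forall y, star x y -> 0 < aff m y -> f y = q y + tpow_comb d l c y) ->
  star x a -> aff m a = 0 -> (forall i, aff (l i) a != 0) ->
  \forall y \near a, f y = q y + tpow_comb d l c y.
Proof.
move=> pq m0 fq sa ma ia.
have [p [pp fp]] := near_piece oU f_pw (proj1 sa) ia.
pose A : set pt := [set y | forall i, has_sign (0 < aff (l i) a) (aff (l i) y)].
have nearA : \forall y \near a, A y.
  by have := @near_signs _ _ l a xpredT (fun i _ => ia i); apply: filterS => y H i; exact: H.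
have [|r [pr Hr]] := @tpow_comb_absorb _ _ d_gt0 _ l A c (fun=> 0).
  move=> i; right; case: (boolP (0 < aff (l i) a)) => [h|/negbTE h]; [left|right];
    by move=> y /(_ i); rewrite h => /ltW.
have SP0 y : tpow_comb d l (fun=> 0) y = 0 by rewrite /tpow_comb big1// => i _; rewrite mul0r.
have near_star : \forall y \near a, star x y.
  by apply: open_nbhs_nbhs; split => //; exact: open_star.
have [a' [ma' good]] : exists a', 0 < aff m a' /\
    \forall y \near a', [/\ star x y, f y = p y & A y].
  near ((0 : R)^'+) => t; exists (a + t *: m.1); split.
    by rewrite aff_lin ma add0r mulr_gt0// lin_grad.
  near: t; apply: (near_line _ (P := fun z : pt => \forall y \near z, [/\ star x y, f y = p y & A y])).
  apply: near_join; near=> y; split; by near: y.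
have pqr y : p y - (q y + r y) = 0.
  move: y; apply: (@poly_le_id _ d _ a').
    by apply: poly_leB => //; exact: poly_leD.
  near=> y; have [sy fpy Ay] : [/\ star x y, f y = p y & A y] by near: y.
  have my : 0 < aff m y by near: y; exact: (@near_sign _ m true).
  by rewrite -fpy fq// Hr// SP0 addr0 subrr.
near=> y; have Ay : A y by near: y.
rewrite Hr// SP0 addr0; apply/eqP; rewrite -subr_eq0; apply/eqP.
by rewrite -[RHS](pqr y); congr (_ - _); near: y.
Unshelve. all: by end_near. Qed.

Lemma near_tpow_comb_poly (a : pt) (q : pt -> R) c : poly_le d q -> (forall i, aff (l i) a != 0) ->
  (\forall y \near a, q y + tpow_comb d l c y = 0) ->
  forall y, q y + \sum_i (if 0 < aff (l i) a then c i else 0) * aff (l i) y ^+ d = 0.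
Proof.
move=> pq ia H; apply: (@poly_le_id _ d _ a).
  by apply: poly_leD => //; apply: poly_le_sum => i; exact/poly_leZ/poly_le_affX.
have near_a := @near_signs _ _ l a xpredT (fun i _ => ia i).
near=> y; rewrite -[RHS](near H y)//; congr (_ + _); apply: eq_bigr => i _.
have : forall i, xpredT i -> has_sign (0 < aff (l i) a) (aff (l i) y) by near: y.
move=> /(_ i isT); case: ifP => _ /ltW h; first by rewrite tpow_ge0.
by rewrite tpow_le0// mul0r mulr0.
Unshelve. all: by end_near. Qed.

Lemma local_rep_vertex x : U x -> (#|[set i | aff (l i) x == 0%R]%SET| <= d.+1)%N ->
  exists c, local_rep d l f c x.
Proof.
move=> Ux cx.
have [m [m0 mx lm]] := generic_line x.
(* The other half-plane is the positive one of the opposite form, so the same lemmas treat both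
   halves. *)
pose m' : R * R * R := (- m.1, - m.2).
have m'E y : aff m' y = - aff m y by rewrite /aff /=; ring.
have m'0 : m'.1 != 0 by rewrite oppr_eq0.
have m'x : aff m' x = 0 by rewrite m'E mx oppr0.
have [c1 [q1 [pq1 c1x fq1]]] := half_rep Ux mx.
have [c2 [q2 [pq2 c2x fq2]]] := half_rep Ux m'x.
pose w := dirv m.
have lw i : lin (l i) w != 0 by rewrite lin_dirv oppr_eq0.
have mw : lin m w = 0 by rewrite lin_dirv /ldet; ring.
pose q y := q1 y - q2 y; pose c i := c1 i - c2 i.
have pq : poly_le d q by exact: poly_leB.
have cx0 i : aff (l i) x != 0 -> c i = 0 by move=> ix; rewrite /c c1x// c2x// subrr.
(* The generic line avoids the other lines away from [x], so near its points on
   either side of [x] both half-plane representations give the same polynomial. *)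
have side k : k != 0 -> exists t, 0 < t /\ forall y, q y +
    \sum_i (if 0 < aff (l i) (x + t *: (k *: w)) then c i else 0) * aff (l i) y ^+ d = 0.
  move=> k0; near ((0 : R)^'+) => t; exists t; split; first by [].
  set a := x + t *: (k *: w).
  have sa : star x a.
    rewrite /a; clear a; near: t; apply: (near_line _ (P := star x)).
    by apply: open_nbhs_nbhs; split; [exact: open_star|exact: star_self].
  have ma : aff m a = 0.
    by rewrite /a aff_lin mx add0r linZ mw !mulr0.
  have ia i : aff (l i) a != 0.
    rewrite /a aff_lin linZ; clear a sa ma.
    suff : forall i, aff (l i) x + t * (k * lin (l i) w) != 0 by apply.
    by near: t; apply: near_affine_neq0 => j; right; rewrite mulf_neq0.
  apply: near_tpow_comb_poly => //.
  have H1 := half_extend pq1 m0 fq1 sa ma ia.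
  have m'a : aff m' a = 0 by rewrite m'E ma oppr0.
  have H2 := half_extend pq2 m'0 fq2 sa m'a ia.
  near=> y; rewrite /q /c tpow_combB addrACA -opprD.
  by rewrite -(near H1 y)// -(near H2 y)// subrr.
have [t1 [t1_gt0 E1]] := side 1 (oner_neq0 R).
have [|t2 [t2_gt0 E2]] := side (-1); first by rewrite oppr_eq0 oner_neq0.
set a1 := _ + _ in E1; set a2 := _ + _ in E2.
pose I := [set i | aff (l i) x == 0]%SET.
have c0 i : c i = 0.
  (* This is [c i] or [- c i] for a line through [x], and 0 for every other line. *)
  pose e i := (if 0 < aff (l i) a1 then c i else 0) - (if 0 < aff (l i) a2 then c i else 0).
  have e0 : forall j, e j = 0.
    apply: (@pows_indep x I) => //.
    - by move=> j; rewrite inE => /eqP.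
    - by move=> j; rewrite inE => /cx0 cj; rewrite /e cj !if_same subrr.
    - move=> y; have E := congr2 (fun u v => u - v) (E1 y) (E2 y).
      rewrite /= opprD addrACA subrr add0r subr0 in E; rewrite -[RHS]E -sumrB.
      by apply: eq_bigr => j _; rewrite mulrBl.
  have [ix|/cx0//] := eqVneq (aff (l i) x) 0.
  have := e0 i; rewrite /e /a1 /a2 scale1r scaleN1r !aff_lin ix !add0r.
  have -> : lin (l i) (- w) = - lin (l i) w by rewrite /lin/=; ring.
  rewrite mulrN oppr_gt0 pmulr_rgt0// pmulr_rlt0//.
  by case: ltgtP (lw i) => // _ _; rewrite ?subr0// sub0r => /eqP; rewrite oppr_eq0 => /eqP.
have q0 y : q y = 0.
  rewrite -[RHS](E1 y) [X in _ + X]big1 ?addr0// => i _.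
  by rewrite c0 if_same mul0r.
have SPE y : tpow_comb d l c2 y = tpow_comb d l c1 y.
  by apply: eq_bigr => i _; move/eqP: (c0 i); rewrite subr_eq0 => /eqP ->.
have qE y : q2 y = q1 y by move/eqP: (q0 y); rewrite subr_eq0 => /eqP.
exists c1, q1; split => //.
suff H y : star x y -> f y = q1 y + tpow_comb d l c1 y.
  by have := open_nbhs_nbhs (conj (@open_star x) (star_self Ux)); apply: filterS.
move=> sy; have [my|my|my] := ltgtP 0 (aff m y); first exact: fq1.
  by rewrite fq2 ?m'E ?oppr_gt0// qE SPE.
(* On the cutting line itself the identity is a limit from the positive side. *)
apply: (@eq_lim_line _ f (fun y => q1 y + tpow_comb d l c1 y) y m.1).
- by have := @f_smooth true 0 y d_gt0 (proj1 sy).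
- apply: cvgD; first exact: (poly_le_continuous pq1).
  exact: tpow_comb_continuous.
- near=> t; apply: fq1.
    near: t; apply: (near_line _ (P := star x)).
    by apply: open_nbhs_nbhs; split=> //; exact: open_star.
  by rewrite aff_lin -my add0r mulr_gt0// lin_grad.
Unshelve. all: by end_near. Qed.

Lemma spline_rep :
  (forall x, U x -> (#|[set i | aff (l i) x == 0%R]%SET| <= d.+1)%N) ->
  exists c (q : pt -> R), poly_le d q /\ forall x, U x -> f x = q x + tpow_comb d l c x.
Proof.
move=> H; apply: local_rep_glob => // x Ux; exact: (local_rep_vertex Ux (H x Ux)).
Qed.

End Vertex.

(** * Barycentric coordinates and interior lines *)

Section Geometry.
Variable R : realType.
Notation pt := (R * R)%type.

(** Vertices and barycentric coordinates are indexed by natural numbers with period 3; this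
    induction reduces a claim to three cases. *)
Lemma nat_ind3 (P : nat -> Prop) : P 0%N -> P 1%N -> P 2%N ->
  (forall n, P n -> P n.+3) -> forall n, P n.
Proof.
move=> P0 P1 P2 PS n; have [H _] : P n /\ P n.+1 /\ P n.+2; last exact: H.
by elim: n => [|n [? [? ?]]]; do !split => //; exact: PS.
Qed.

Definition cross (a b c : pt) : R :=
  (b.1 - a.1) * (c.2 - a.2) - (b.2 - a.2) * (c.1 - a.1).

Lemma crossC a b c : cross b c a = cross a b c.
Proof. by rewrite /cross; ring. Qed.

Variables (p1 p2 p3 : pt).
Hypothesis nondeg : nondegenerate_triangle p1 p2 p3.
Let V := tri_vtx p1 p2 p3.

Lemma tri_vtxS3 n : V n.+3 = V n.
Proof. by rewrite /V /tri_vtx -(addn3 n) modnDr. Qed.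

Lemma tri_vtx_mod n : V (n %% 3) = V n.
Proof. by rewrite /V /tri_vtx modn_mod. Qed.

Lemma cross_vtx e : cross (V e) (V e.+1) (V e.+2) != 0.
Proof.
suff -> : cross (V e) (V e.+1) (V e.+2) = cross p1 p2 p3 by [].
elim/nat_ind3: e => [|||n]; rewrite ?tri_vtxS3 //; rewrite /V /tri_vtx /= /cross; ring.
Qed.

(** The barycentric coordinate of vertex [e], as a quotient of signed areas: the numerator at [x] is
    [cross x b c]. *)
Definition bary (e : nat) : R * R * R :=
  let D := cross (V e) (V e.+1) (V e.+2) in let b := V e.+1 in let c := V e.+2 in
  ((b.2 - c.2) / D, (c.1 - b.1) / D, (b.1 * c.2 - b.2 * c.1) / D).

Notation lam e := (aff (bary e)).

Lemma baryS3 e : bary e.+3 = bary e.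
Proof. by rewrite /bary !tri_vtxS3. Qed.

Lemma lam_sum e x : lam e x + lam e.+1 x + lam e.+2 x = 1.
Proof.
have := cross_vtx e; rewrite /aff /bary !tri_vtxS3 !(crossC (V e)) crossC /cross /= => h.
by field.
Qed.

Lemma lam_vtx e : [/\ lam e (V e) = 1, lam e (V e.+1) = 0 & lam e (V e.+2) = 0].
Proof.
have := cross_vtx e; rewrite /aff /bary /cross /= => h.
by split; field.
Qed.

Lemma lam_dec e x : x = lam e x *: V e + lam e.+1 x *: V e.+1 + lam e.+2 x *: V e.+2.
Proof.
have := cross_vtx e; rewrite /aff /bary !tri_vtxS3 !(crossC (V e)) crossC /cross /= => h.
rewrite [LHS]surjective_pairing; congr (_, _); by rewrite /= /GRing.scale/=; field.
Qed.

Lemma lam_inj e x y : lam e x = lam e y -> lam e.+2 x = lam e.+2 y -> x = y.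
Proof.
move=> h0 h2; rewrite (lam_dec e x) (lam_dec e y) h0 h2.
suff -> : lam e.+1 x = lam e.+1 y by [].
have := lam_sum e x; rewrite h0 h2 -(lam_sum e y) => /addIr; exact: addrI.
Qed.

Lemma aff_comb (m : R * R * R) (a b c : R) (x y z : pt) : a + b + c = 1 ->
  aff m (a *: x + b *: y + c *: z) = a * aff m x + b * aff m y + c * aff m z.
Proof.
move=> abc; rewrite /aff /= /GRing.scale/= -[m.2 in LHS]mul1r -abc; ring.
Qed.

Lemma triangleP x : triangle p1 p2 p3 x <-> forall e, 0 <= lam e x.
Proof.
have [l00 l01 l02] := lam_vtx 0; have [l11 l12 l10] := lam_vtx 1.
have [l22 l20 l21] := lam_vtx 2; rewrite tri_vtxS3 in l10 l20.
rewrite (tri_vtxS3 1) in l21.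
split=> [[a [b [c [a0 b0 c0 abc ->]]]] e|H].
  change (0 <= lam e (a *: V 0 + b *: V 1 + c *: V 2)); rewrite aff_comb//.
  elim/nat_ind3: e => [|||n]; last by rewrite baryS3.
  - by rewrite l00 l01 l02; lra.
  - by rewrite l11 l12 l10; lra.
  - by rewrite l22 l20 l21; lra.
exists (lam 0 x), (lam 1 x), (lam 2 x); split; rewrite ?lam_sum//.
exact: (lam_dec 0 x).
Qed.

Definition inner : set pt := [set x | forall e, 0 < lam e x].

Lemma innerE : inner = [set y | has_sign true (lam 0 y)] `&`
  [set y | has_sign true (lam 1 y)] `&` [set y | has_sign true (lam 2 y)].
Proof.
rewrite seteqP; split=> x /= => [H|[[h0 h1] h2] e]; first by rewrite !H.
by elim/nat_ind3: e => // n; rewrite baryS3.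
Qed.

Lemma open_inner : open inner.
Proof.
rewrite innerE; apply: openI; [apply: openI|];
  by rewrite openE => y; exact: near_sign.
Qed.

Lemma cvx_inner : cvx inner.
Proof. by rewrite innerE; do !apply: cvx_setI; exact: cvx_aff_sign. Qed.

Lemma inner_triangle : inner `<=` triangle p1 p2 p3.
Proof. by move=> x Hx; apply/triangleP => e; exact/ltW. Qed.

Lemma inner_interior : inner `<=` interior (triangle p1 p2 p3).
Proof. by rewrite -open_subsetE; [exact: inner_triangle|exact: open_inner]. Qed.

Lemma closed_triangle : closed (triangle p1 p2 p3).
Proof.
rewrite (_ : triangle p1 p2 p3 = \bigcap_e [set x | 0 <= lam e x]); last first.
  rewrite seteqP; split=> [x /triangleP H e _|x H]; first exact: H.
  by apply/triangleP => e; exact: H.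
apply: closed_bigI => e _.
exact: (closed_comp (fun x _ => @aff_continuous _ (bary e) x) (@closed_ge _ 0)).
Qed.

Variables (d : nat) (d_gt0 : (0 < d)%N).

Definition edge_pt (e : nat) (k : nat) : pt := V e + (k%:R / d%:R) *: (V e.+1 - V e).

Lemma ws_pointE (k : 'I_(3 * d)) : ws_point p1 p2 p3 k = edge_pt (k %/ d) (k %% d).
Proof. by []. Qed.

Lemma edge_pt_mod e k : edge_pt (e %% 3) k = edge_pt e k.
Proof.
rewrite /edge_pt (_ : V (e %% 3).+1 = V e.+1) ?tri_vtx_mod//.
by rewrite -(tri_vtx_mod (e %% 3).+1) -addn1 modnDml addn1 tri_vtx_mod.
Qed.

Lemma lam_edge e k : [/\ lam e (edge_pt e k) = 1 - k%:R / d%:R,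
  lam e.+1 (edge_pt e k) = k%:R / d%:R & lam e.+2 (edge_pt e k) = 0].
Proof.
have [l1 l2 _] := lam_vtx e; have [l3 _ l4] := lam_vtx e.+1.
have [_ l5 l6] := lam_vtx e.+2; rewrite !tri_vtxS3 in l4 l5 l6.
by rewrite /edge_pt; split; rewrite aff_seg ?(l1, l2, l3, l4, l5, l6); ring.
Qed.

(* The line through [edge_pt e r] and [edge_pt e.+1 s.+1] in barycentric
   coordinates.  Orienting an interior line from edge e to edge e + 1 (mod 3) and
   excluding the common vertex ([s.+1] instead of [s]) lists each of the 3d(d-1)
   interior lines exactly once. *)
Definition chord (e r s : nat) : R * R * R :=
  (d%:R / (d - r)%:R) *: bary e + (d%:R / s.+1%:R) *: bary e.+2 - (0, 0, 1).

Lemma aff_chord e r s x : aff (chord e r s) x =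
  (d%:R / (d - r)%:R) * lam e x + (d%:R / s.+1%:R) * lam e.+2 x - 1.
Proof. by rewrite /chord /aff /= /GRing.scale/=; ring. Qed.

(** The chord cuts the vertex [e + 1] off from the other two, and passes through vertex [e] when
    [r = 0]. This sign pattern, with the normalising value -1, tells chords apart. *)
Lemma chord_vtx e r s : (r < d)%N -> (s < d.-1)%N ->
  [/\ 0 <= aff (chord e r s) (V e), aff (chord e r s) (V e.+1) = -1 &
      0 < aff (chord e r s) (V e.+2)].
Proof.
move=> rd sd; rewrite !aff_chord.
have [l1 l2 l3] := lam_vtx e; have [l4 l5 l6] := lam_vtx e.+2.
rewrite !tri_vtxS3 in l5 l6; rewrite l1 l2 l3 l4 l5 l6 !mulr0 !mulr1 !addr0 !add0r.
have r0 : 0 < (d - r)%:R :> R by rewrite ltr0n subn_gt0.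
rewrite subr_ge0 ler_pdivlMr// mul1r ler_nat leq_subr.
rewrite subr_gt0 ltr_pdivlMr// mul1r ltr_nat; split => //.
by case: d sd => // n; rewrite ltnS.
Qed.

Lemma chord_edge e r s : (r < d)%N -> (s < d.-1)%N ->
  aff (chord e r s) (edge_pt e r) = 0 /\ aff (chord e r s) (edge_pt e.+1 s.+1) = 0.
Proof.
move=> rd sd; rewrite !aff_chord.
have [l1 _ l2] := lam_edge e r; have [_ l3 l4] := lam_edge e.+1 s.+1.
rewrite baryS3 in l4; rewrite l1 l2 l3 l4.
have d0 : d%:R != 0 :> R by rewrite pnatr_eq0 -lt0n.
have s0 : s.+1%:R != 0 :> R by rewrite pnatr_eq0.
have : (d - r)%:R != 0 :> R by rewrite pnatr_eq0 -lt0n subn_gt0.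
rewrite (natrB _ (ltnW rd)); move: s0 d0.
move: (s.+1%:R : R) (r%:R : R) (d%:R : R) => S r' d' S0 d0 r0.
by split; field; rewrite ?d0 ?S0 ?r0.
Qed.

(** In the triangle the two barycentric terms of the chord equation are non-negative and add up to
    1: they are the weights of the end points. *)
Lemma chord_segment e r s x : (r < d)%N -> (s < d.-1)%N ->
  triangle p1 p2 p3 x -> aff (chord e r s) x = 0 ->
  segment (edge_pt e r) (edge_pt e.+1 s.+1) x.
Proof.
move=> rd sd /triangleP Tx; rewrite aff_chord => cx.
have [l1 _ l2] := lam_edge e r; have [_ l3 l4] := lam_edge e.+1 s.+1.
rewrite baryS3 in l4.
have d0 : 0 < d%:R :> R by rewrite ltr0n.
have s0 : 0 < s.+1%:R :> R by rewrite ltr0n.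
have r0 : 0 < (d - r)%:R :> R by rewrite ltr0n subn_gt0.
have rE : (d - r)%:R = d%:R - r%:R :> R by rewrite natrB// ltnW.
set t := d%:R / s.+1%:R * lam e.+2 x in cx.
have t0 : 0 <= t by rewrite mulr_ge0// divr_ge0// ltW.
have t1 : d%:R / (d - r)%:R * lam e x = 1 - t by move: cx; lra.
have t2 : 0 <= 1 - t by rewrite -t1 mulr_ge0// divr_ge0// ltW.
exists t; split; first by rewrite t0 -subr_ge0 t2.
have dn : d%:R != 0 :> R by rewrite gt_eqF.
have sn : s.+1%:R != 0 :> R by rewrite gt_eqF.
have rn : d%:R - r%:R != 0 :> R by rewrite -rE gt_eqF.
have segE m : aff m ((1 - t) *: edge_pt e r + t *: edge_pt e.+1 s.+1) =
    (1 - t) * aff m (edge_pt e r) + t * aff m (edge_pt e.+1 s.+1).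
  by rewrite /aff /= /GRing.scale/=; ring.
apply: (@lam_inj e); rewrite segE ?l1 ?l2 ?l3 ?l4.
  rewrite -t1 rE mulr0 addr0; move: dn rn; move: (d%:R : R) (r%:R : R) => d' r' dn rn.
  by field; rewrite dn rn.
rewrite /t mulr0 add0r; move: dn sn; move: (d%:R : R) (s.+1%:R : R) => d' s' dn sn.
by field; rewrite dn sn.
Qed.

Lemma segment_aff (m : R * R * R) a b x : segment a b x -> exists t,
  [/\ 0 <= t, t <= 1 & aff m x = (1 - t) * aff m a + t * aff m b].
Proof.
move=> [t [/andP[t0 t1] ->]]; exists t; split => //.
by rewrite /aff /= /GRing.scale/=; ring.
Qed.

Lemma segment_chord e r s x : (r < d)%N -> (s < d.-1)%N ->
  segment (edge_pt e r) (edge_pt e.+1 s.+1) x -> aff (chord e r s) x = 0.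
Proof.
move=> rd sd /(segment_aff (chord e r s))[t [_ _ ->]].
by have [-> ->] := chord_edge e rd sd; rewrite !mulr0 addr0.
Qed.

Definition idx : finType := ('I_3 * 'I_d * 'I_d.-1)%type.
Definition chords (i : idx) : R * R * R := chord i.1.1 i.1.2 i.2.

Lemma I3_cases (e e' : 'I_3) : [\/ e = e', e' = (e.+1 %% 3)%N :> nat | e = (e'.+1 %% 3)%N :> nat].
Proof.
case: e e' => [[|[|[|//]]] ?] [[|[|[|//]]] ?];
  by [apply: Or31; apply/val_inj|apply: Or32|apply: Or33].
Qed.

Lemma chords_nondeg : lines_nondeg chords.
Proof.
move=> i; apply/eqP => i0.
have [_ h1 h2] := chord_vtx i.1.1 (ltn_ord i.1.2) (ltn_ord i.2).
have cE x : aff (chords i) x = (chords i).2.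
  by rewrite /aff i0 /= !mul0r !add0r.
by move: h1 h2; rewrite -/(chords i) !cE => ->; rewrite oppr_gt0 ltr10.
Qed.

Lemma ldet0_prop (m n : R * R * R) (x : pt) : m.1 != 0 -> ldet m n = 0 ->
  aff m x = 0 -> aff n x = 0 -> exists k, forall y, aff n y = k * aff m y.
Proof.
move=> m0 mn mx nx; exists (lin n m.1 / lin m m.1) => y.
have k0 : lin m m.1 != 0 by rewrite gt_eqF// lin_grad.
have E l : aff l x = 0 -> aff l y = lin l (y - x).
  by move=> lx; have := aff_lin l x 1 (y - x); rewrite -lineE lx add0r mul1r.
rewrite !E// mulrAC; apply: (canRL (mulfK k0)).
apply/eqP; rewrite -subr_eq0; apply/eqP.
rewrite (_ : _ - _ = ldet m n * (m.1.1 * (y - x).2 - m.1.2 * (y - x).1)); last first.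
  by rewrite /ldet /lin; ring.
by rewrite mn mul0r.
Qed.

(** Parallel forms with a common zero are proportional. With the same [e] the value -1 forces the
    factor 1, and the values at the other two vertices give back [r] and [s]. With different [e] no
    factor reconciles the sign patterns at the vertices. *)
Lemma chords_indep : lines_indep chords.
Proof.
move=> i j x ij ix jx; apply/eqP => det0.
have [k Hk] := ldet0_prop (chords_nondeg i) det0 ix jx.
have [i0 i1 i2] := chord_vtx i.1.1 (ltn_ord i.1.2) (ltn_ord i.2).
have [j0 j1 j2] := chord_vtx j.1.1 (ltn_ord j.1.2) (ltn_ord j.2).
rewrite -/(chords i) in i0 i1 i2; rewrite -/(chords j) !Hk in j0 j1 j2.
have VS (a b : nat) n : a = (b.+1 %% 3)%N -> V (n + a)%N = V (n + b.+1)%N.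
  by move=> ->; rewrite -(tri_vtx_mod (n + _)) modnDmr tri_vtx_mod.
case: (I3_cases i.1.1 j.1.1) => eij.
- have k1 : k = 1 by move: j1; rewrite -eij i1; lra.
  have vE n : aff (chords j) (V n) = aff (chords i) (V n) by rewrite Hk k1 mul1r.
  have [l1 l2 l3] := lam_vtx i.1.1; have [l4 l5 l6] := lam_vtx i.1.1.+2.
  rewrite !tri_vtxS3 in l5 l6.
  move: (vE i.1.1) (vE i.1.1.+2); rewrite !aff_chord -eij l1 l3 l4 l5.
  rewrite !mulr0 !mulr1 !addr0 !add0r => /addIr h1 /addIr h2.
  have d0 : d%:R != 0 :> R by rewrite pnatr_eq0 -lt0n.
  move/(mulfI d0)/invr_inj/eqP: h1; rewrite eqr_nat => /eqP h1.
  move/(mulfI d0)/invr_inj/eqP: h2; rewrite eqr_nat => /eqP[h2].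
  move: ij; rewrite [i]surjective_pairing [i.1]surjective_pairing.
  rewrite [j]surjective_pairing [j.1]surjective_pairing eij.
  rewrite (_ : i.2 = j.2); last exact/val_inj.
  rewrite (_ : i.1.2 = j.1.2) ?eqxx//; apply/val_inj => /=.
  by rewrite -[LHS](subKn (ltnW (ltn_ord _))) -h1 subKn// ltnW.
- move: j0 j1 j2.
  rewrite (VS _ _ 0%N eij) (VS _ _ 1%N eij) (VS _ _ 2%N eij) !add0n !add1n !add2n tri_vtxS3.
  by rewrite i1; nra.
- move: i0 i1 i2.
  rewrite (VS _ _ 0%N eij) (VS _ _ 1%N eij) (VS _ _ 2%N eij) !add0n !add1n !add2n tri_vtxS3.
  by move: j0 j1 j2; nra.
Qed.

End Geometry.

(** * Splines on the Wang--Shi split *)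

Section Split.
Variable R : realType.
Notation pt := (R * R)%type.
Variables (p1 p2 p3 : pt) (nondeg : nondegenerate_triangle p1 p2 p3).
Variables (d : nat) (d_gt0 : (0 < d)%N).
Notation V := (tri_vtx p1 p2 p3).
Notation T := (triangle p1 p2 p3).
Notation lam e := (aff (bary p1 p2 p3 e)).
Notation inner := (inner p1 p2 p3).
Notation chords := (@chords R p1 p2 p3 d).
Notation ws := (@ws_point R p1 p2 p3 d).
Notation edge_pt := (edge_pt p1 p2 p3 d).

Lemma inner_from e x : 0 < lam e x -> 0 < lam e.+1 x -> 0 < lam e.+2 x -> inner x.
Proof.
elim: e => [|e IH] h0 h1 h2; last by apply: IH; rewrite // -baryS3.
by move=> n; elim/nat_ind3: n => // n; rewrite baryS3.
Qed.

Lemma inner_nonempty : exists g, inner g.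
Proof.
exists ((3^-1) *: V 0 + (3^-1) *: V 1 + (3^-1) *: V 2).
have [l00 l01 l02] := lam_vtx nondeg 0; have [l11 l12 l10] := lam_vtx nondeg 1.
have [l22 l20 l21] := lam_vtx nondeg 2; rewrite tri_vtxS3 in l10 l20.
rewrite (tri_vtxS3 _ _ _ 1) in l21.
have e3 : 3^-1 + 3^-1 + 3^-1 = 1 :> R by lra.
by apply: (@inner_from 0); rewrite aff_comb// ?(l00, l01, l02, l11, l12, l10, l22, l20, l21); lra.
Qed.

(** Provides an interior point on each chord, where linear independence of the truncated powers is
    tested. *)
Lemma lam_mid e (r s : nat) : (r < d)%N -> (s < d.-1)%N ->
  inner (edge_pt e r + 2^-1 *: (edge_pt e.+1 s.+1 - edge_pt e r)).
Proof.
move=> rd sd; have d0 : 0 < d%:R :> R by rewrite ltr0n.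
have [l1 l2 l3] := lam_edge nondeg d e r; have [l4 l5 l6] := lam_edge nondeg d e.+1 s.+1.
rewrite baryS3 in l6.
have r0 : r%:R / d%:R < 1 :> R by rewrite ltr_pdivrMr// mul1r ltr_nat.
have r1 : 0 <= r%:R / d%:R :> R by rewrite divr_ge0.
have s0 : s.+1%:R / d%:R < 1 :> R.
  by rewrite ltr_pdivrMr// mul1r ltr_nat -ltn_predRL.
have s1 : 0 < s.+1%:R / d%:R :> R by rewrite divr_gt0.
by apply: (@inner_from e); rewrite aff_seg ?(l1, l2, l3, l4, l5, l6); lra.
Qed.

Lemma segment_sym (a b x : pt) : segment a b x -> segment b a x.
Proof.
move=> [t [/andP[t0 t1] ->]]; exists (1 - t); split; first by rewrite subr_ge0 t1 gerBl.
by rewrite subKr addrC.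
Qed.

Lemma inner_not_edge e (a b x : pt) : inner x -> lam e a = 0 -> lam e b = 0 ->
  ~ segment a b x.
Proof.
move=> Ux ea eb /(segment_aff (bary p1 p2 p3 e))[t [_ _ E]].
by have := Ux e; rewrite E ea eb !mulr0 addr0 ltxx.
Qed.

Lemma inner_segment_next (i j : 'I_(3 * d)) x : inner x ->
  (j %/ d = (i %/ d).+1 %% 3)%N -> segment (ws i) (ws j) x ->
  exists k, aff (chords k) x = 0.
Proof.
move=> Ux ij; rewrite !ws_pointE ij edge_pt_mod => ijx.
have e3 : (i %/ d < 3)%N by rewrite ltn_divLR.
have rd : (i %% d < d)%N by rewrite ltn_mod.
case E : (j %% d)%N ijx => [|s] ijx.
  (* The second end is the vertex common to both edges, so the segment runs inside an edge. *)
  exfalso; apply: (inner_not_edge (e := (i %/ d).+2) Ux) ijx.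
    by have [] := lam_edge nondeg d (i %/ d) (i %% d).
  by have [_ ->] := lam_edge nondeg d (i %/ d).+1 0; rewrite mul0r.
have sd : (s < d.-1)%N by rewrite ltn_predRL -E ltn_mod.
exists (Ordinal e3, Ordinal rd, Ordinal sd).
exact: (segment_chord nondeg d_gt0 rd sd ijx).
Qed.

Lemma inner_segment (i j : 'I_(3 * d)) x : inner x -> segment (ws i) (ws j) x ->
  exists k, aff (chords k) x = 0.
Proof.
move=> Ux ijx.
have i3 : (i %/ d < 3)%N by rewrite ltn_divLR.
have j3 : (j %/ d < 3)%N by rewrite ltn_divLR.
have [[ij]|/= ij|/= ij] := I3_cases (Ordinal i3) (Ordinal j3).
- exfalso; move: ijx; rewrite !ws_pointE -ij.
  apply: (inner_not_edge (e := (i %/ d).+2) Ux);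
  by [have [] := lam_edge nondeg d (i %/ d) (i %% d)|
      have [] := lam_edge nondeg d (i %/ d) (j %% d)].
- exact: inner_segment_next Ux ij ijx.
- exact: inner_segment_next Ux ij (segment_sym ijx).
Qed.

Lemma ws_idx_proof e r : (e < 3)%N -> (r < d)%N -> (e * d + r < 3 * d)%N.
Proof.
move=> e3 rd; apply: (@leq_trans (e.+1 * d)); last by rewrite leq_mul2r e3 orbT.
by rewrite mulSn addnC ltn_add2r.
Qed.

Definition ws_idx (e : 'I_3) (r : 'I_d) : 'I_(3 * d) :=
  Ordinal (ws_idx_proof (ltn_ord e) (ltn_ord r)).

Lemma ws_idx_div e r : (ws_idx e r %/ d = e)%N.
Proof. by rewrite /= divnMDl// divn_small// addn0. Qed.

Lemma ws_idx_mod e r : (ws_idx e r %% d = r)%N.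
Proof. by rewrite /= modnMDl modn_small. Qed.

Lemma pred_ord_proof (s : 'I_d.-1) : (s.+1 < d)%N.
Proof. by rewrite -ltn_predRL. Qed.

Definition chord_src (i : idx d) : 'I_(3 * d) := ws_idx i.1.1 i.1.2.
Definition chord_tgt (i : idx d) : 'I_(3 * d) :=
  ws_idx (Ordinal (ltn_pmod i.1.1.+1 (isT : (0 < 3)%N))) (Ordinal (pred_ord_proof i.2)).

Lemma ws_src i : ws (chord_src i) = edge_pt i.1.1 i.1.2.
Proof. by rewrite ws_pointE ws_idx_div ws_idx_mod. Qed.

Lemma ws_tgt i : ws (chord_tgt i) = edge_pt i.1.1.+1 i.2.+1.
Proof. by rewrite ws_pointE ws_idx_div ws_idx_mod edge_pt_mod. Qed.

Lemma chord_ws_segment i x : T x -> aff (chords i) x = 0 ->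
  segment (ws (chord_src i)) (ws (chord_tgt i)) x.
Proof. by rewrite ws_src ws_tgt; exact: chord_segment. Qed.

Lemma next3_neq (e : 'I_3) : (e.+1 %% 3 != e)%N.
Proof. by case: e => [[|[|[|]]]]. Qed.

Lemma src_neq_tgt i : chord_src i != chord_tgt i.
Proof.
apply/eqP => E; have := next3_neq i.1.1.
have := congr1 (fun k : 'I_(3 * d) => (k %/ d)%N) E.
by rewrite /chord_src /chord_tgt !ws_idx_div /= => <-; rewrite eqxx.
Qed.

Lemma chord_ws_union i x : T x -> aff (chords i) x = 0 -> ws_union p1 p2 p3 d x.
Proof.
move=> Tx ix; exists (chord_src i), (chord_tgt i); split; first exact: src_neq_tgt.
exact: chord_ws_segment.
Qed.

(** Sorted, because [ws_lines_through] counts pairs with increasing indices, whereas a chord leading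
    from edge 2 to edge 0 decreases. *)
Definition chord_ends (i : idx d) : 'I_(3 * d) * 'I_(3 * d) :=
  if (chord_src i < chord_tgt i)%N then (chord_src i, chord_tgt i)
  else (chord_tgt i, chord_src i).

Lemma chord_ends_inj : injective chord_ends.
Proof.
have aux (i j : idx d) : chord_src i = chord_src j -> chord_tgt i = chord_tgt j -> i = j.
  move=> E1 E2.
  have := congr1 (fun k : 'I_(3 * d) => (k %/ d)%N) E1; rewrite !ws_idx_div => e1.
  have := congr1 (fun k : 'I_(3 * d) => (k %% d)%N) E1; rewrite !ws_idx_mod => e2.
  have := congr1 (fun k : 'I_(3 * d) => (k %% d)%N) E2; rewrite !ws_idx_mod => -[e3].
  move: i j e1 e2 e3 {E1 E2} => [[i1 i2] i3] [[j1 j2] j3] /= e1 e2 e3.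
  by congr (_, _, _); apply/val_inj.
have aux2 (i j : idx d) : chord_src i = chord_tgt j -> chord_tgt i = chord_src j -> False.
  move=> E1 E2.
  have := congr1 (fun k : 'I_(3 * d) => (k %/ d)%N) E1; rewrite !ws_idx_div /=.
  have := congr1 (fun k : 'I_(3 * d) => (k %/ d)%N) E2; rewrite !ws_idx_div /=.
  by move: i.1.1 j.1.1 => [[|[|[|//]]] ?] [[|[|[|//]]] ?].
move=> i j; rewrite /chord_ends; case: ifP => _; case: ifP => _ E;
  have /= E1 := congr1 fst E; have /= E2 := congr1 snd E.
- exact: aux.
- by case: (aux2 i j).
- by case: (aux2 i j).
- exact: aux.
Qed.

Lemma chords_through x : T x ->
  (#|[set i | aff (chords i) x == 0%R]%SET| <= ws_lines_through p1 p2 p3 d x)%N.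
Proof.
move=> Tx; rewrite -(card_imset _ chord_ends_inj); apply: subset_leq_card.
apply/fintype.subsetP => z /imsetP[i ix ->]; rewrite inE in ix; move/eqP: ix => ix.
rewrite -topredE /=; apply/asboolP => /=.
have := chord_ws_segment Tx ix; rewrite /chord_ends => six.
have ne := src_neq_tgt i.
have [h|h|h] := ltngtP (chord_src i : nat) (chord_tgt i); rewrite /=.
- by rewrite h/=; exact/asboolP.
- by rewrite h/=; apply/asboolP; exact: segment_sym.
- by case/eqP: ne; exact/val_inj.
Qed.

Lemma chords_at_most x :
  (forall x : pt, ws_interior_vertex p1 p2 p3 d x -> (ws_lines_through p1 p2 p3 d x <= d.+1)%N) ->
  inner x -> (#|[set i | aff (chords i) x == 0%R]%SET| <= d.+1)%N.
Proof.
move=> H Ux; have := chords_through (inner_triangle nondeg Ux).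
(* The hypothesis speaks of vertices only; with at most one chord through [x] the bound is
   trivial. *)
set n := #|_|; have [n2|] := leqP 2 n; last by rewrite ltnS => n1 _; exact: leq_trans n1 _.
move=> nl; apply: (leq_trans nl); apply: H; split; first exact: inner_interior.
exact: leq_trans nl.
Qed.

(** A sign cell of the open triangle is convex and avoids all segments of the split, so it lies in
    one connected component, hence in one polygon. *)
Lemma spline_piece f (s : idx d -> bool) : ws_spline_space p1 p2 p3 d f ->
  exists q : pt -> R, poly_le d q /\
  forall y, inner y -> (forall i, has_sign (s i) (aff (chords i) y)) -> f y = q y.
Proof.
move=> [_ _ fP].
pose A := inner `&` [set y | forall i, has_sign (s i) (aff (chords i) y)].
have cA : cvx A.
  apply: cvx_setI; first exact: cvx_inner.
  by move=> y z t Hy Hz t01 i; exact: (cvx_aff_sign (Hy i) (Hz i)).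
have [[x Ax]|A0] := pselect (exists x, A x); last first.
  exists (fun=> 0); split=> [|y Uy sy]; first exact: poly_le0.
  by case: A0; exists y.
pose O := T `\` ws_union p1 p2 p3 d.
have AO : A `<=` O.
  move=> y [Uy sy]; split; first exact: inner_triangle.
  move=> [i [j [_ /(inner_segment Uy)[k ky]]]].
  by have := sy k; rewrite ky /has_sign ltxx; case: ifP.
have [|q [pq fq]] := fP (closure (connected_component O x)).
  by exists x => //; exact: AO.
exists q; split => // y Uy sy; apply: fq; apply: subset_closure.
have Ay : A y by [].
pose S := [set x + t *: (y - x) | t in `[0, 1]%classic].
have SA : S `<=` A by exact: cvx_segment.
apply: (@connected_component_max _ O S x).
- by exists 0; rewrite /= ?in_itv/= ?ler01 ?lexx// scale0r addr0.
- by move=> z /SA /AO.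
- exact: segment_image_connected.
- by exists 1; rewrite /= ?in_itv/= ?ler01 ?lexx// -lineE.
Qed.

(** At an interior point the continuous extension provided by [Cr_on] coincides with the derivative
    on a whole neighbourhood. *)
Lemma spline_smooth f b j x : Cr_on (d - 1) T f -> (j < d)%N -> inner x ->
  {for x, continuous (Defs.iterD f (nseq j b))}.
Proof.
move=> [_ _ fC] jd Ux.
have [|h [hT hE]] := fC (nseq j b); first by rewrite size_nseq subn1 -ltnS prednK.
have Tx : interior T x by exact: inner_interior.
have hx : h @ x --> h x.
  move/subspace_continuousP: hT => /(_ x (interior_subset Tx)).
  by rewrite within_interior.
rewrite /prop_for /continuous_at -hE//; apply: cvg_trans hx.
apply: near_eq_cvg; have := nbhs_interior Tx.
by apply: filterS => y Ty; exact: hE.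
Qed.

Lemma spline_rep_triangle f : ws_spline_space p1 p2 p3 d f ->
  (forall x : pt, ws_interior_vertex p1 p2 p3 d x -> (ws_lines_through p1 p2 p3 d x <= d.+1)%N) ->
  exists c (q : pt -> R), poly_le d q /\ forall x, T x -> f x = q x + tpow_comb d chords c x.
Proof.
move=> fS H; have [_ fC _] := fS.
have [|c [q [pq fq]]] := spline_rep d_gt0 (@chords_nondeg _ _ _ _ nondeg d)
  (chords_indep nondeg d_gt0) (@open_inner R p1 p2 p3) (@cvx_inner R p1 p2 p3)
  (f := f) (fun b j x => @spline_smooth f b j x fC) (fun s => @spline_piece f s fS).
  by move=> x; exact: chords_at_most.
exists c, q; split => // x Tx.
have [g Ug] := inner_nonempty.
pose v := g - x.
have xv_inner t : 0 < t -> t <= 1 -> inner (x + t *: v).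
  move=> t0 t1 e; rewrite aff_seg.
  have := (triangleP nondeg x).1 Tx e; have := Ug e; nra.
(* [f] is continuous only relative to the triangle, so the approach from the interior point [g] has
   to stay inside it. *)
have xv : x + t *: v @[t --> 0^'+] --> within T (nbhs x).
  move=> P xP; change (\forall t \near 0^'+, P (x + t *: v)).
  near=> t; have : T (x + t *: v) -> P (x + t *: v).
    by near: t; exact: (@near_line _ x v (fun z => T z -> P z) xP).
  apply; apply: inner_triangle => //; apply: xv_inner => //.
  by near: t; exact: nbhs_right_le.
have fx : f (x + t *: v) @[t --> 0^'+] --> f x.
  have [/subspace_continuousP /(_ x Tx) fx _ _] := fC.
  exact: (cvg_comp _ _ xv fx).
pose G y := q y + tpow_comb d chords c y.
have Gx : G (x + t *: v) @[t --> 0^'+] --> G x.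
  have xv' : x + t *: v @[t --> 0^'+] --> x.
    by apply: cvg_at_right_filter; exact: cvg_line.
  apply: (cvg_comp _ _ xv'); apply: cvgD; first exact: (poly_le_continuous pq).
  exact: tpow_comb_continuous.
have fx' : f (x + t *: v) @[t --> 0^'+] --> G x.
  apply: cvg_trans Gx; apply: near_eq_cvg; near=> t.
  by rewrite /G -fq//; apply: xv_inner => //; near: t; exact: nbhs_right_le.
exact: cvg_unique fx fx'.
Unshelve. all: by end_near. Qed.

Lemma polygon_triangle P : ws_polygons p1 p2 p3 d P -> P `<=` T.
Proof.
move=> [x _ <-]; have /closure_id E := closed_triangle nondeg.
set C := closure _; suff : C `<=` closure T by rewrite -E.
by apply: closure_subset => y /connected_component_sub[].
Qed.

(** On the component the form has an interval as image that misses 0; the closure keeps the weak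
    sign. *)
Lemma polygon_sign P i : ws_polygons p1 p2 p3 d P ->
  (forall y, P y -> 0 <= aff (chords i) y) \/ (forall y, P y -> aff (chords i) y <= 0).
Proof.
move=> [x _ <-]; set O := _ `\` _; set C := connected_component O x.
have C0 y : C y -> aff (chords i) y != 0.
  move=> /connected_component_sub [Ty nU]; apply/eqP => iy.
  exact: nU (chord_ws_union Ty iy).
have ci : is_interval (aff (chords i) @` C).
  apply/connected_intervalP; apply: connected_continuous_connected.
    exact: component_connected.
  exact/continuous_subspaceT/aff_continuous.
have [[y [Cy iy]]|none] := pselect (exists y, C y /\ aff (chords i) y < 0).
- right; suff H : C `<=` [set z | aff (chords i) z <= 0].
    have /closure_id E : closed [set z | aff (chords i) z <= 0].
      exact: (closed_comp (fun x _ => @aff_continuous _ (chords i) x) (@closed_le _ 0)).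
    by move=> z /(closure_subset H); rewrite -E.
  move=> z Cz /=; rewrite leNgt; apply/negP => iz.
  have [u Cu u0] : (aff (chords i) @` C) 0.
    by apply: (ci (aff (chords i) y) (aff (chords i) z));
      [exists y|exists z|rewrite !ltW].
  by have := C0 u Cu; rewrite u0 eqxx.
- left; suff H : C `<=` [set z | 0 <= aff (chords i) z].
    have /closure_id E : closed [set z | 0 <= aff (chords i) z].
      exact: (closed_comp (fun x _ => @aff_continuous _ (chords i) x) (@closed_ge _ 0)).
    by move=> z /(closure_subset H); rewrite -E.
  by move=> z Cz /=; rewrite leNgt; apply/negP => iz; apply: none; exists z.
Qed.

End Split.

(** * Membership and dimension *)

Section Membership.
Variable R : realType.
Notation pt := (R * R)%type.

(** Differentiability of class [n] on the whole plane, with partial derivatives supplied as explicit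
    functions; [Cr_on] follows by restriction. *)
Fixpoint smooth (n : nat) (F : pt -> R) : Prop :=
  continuous F /\ if n is m.+1 then forall b, exists G, smooth m G /\
    forall x, is_derive x (coord_dir R b) F (G x) else True.

Lemma smooth_continuous n F : smooth n F -> continuous F.
Proof. by case: n => [|n] []. Qed.

Lemma smooth_iterD n F s : smooth n F -> (size s <= n)%N ->
  smooth (n - size s) (Defs.iterD F s).
Proof.
move=> nF; elim: s => [|b s IH] /= sn; first by rewrite subn0.
have := IH (ltnW sn); case E : (n - size s)%N => [|m].
  by move/eqP: E; rewrite subn_eq0 leqNgt sn.
move=> /= [_ /(_ b)[G [mG GE]]]; rewrite subnS E /=.
suff -> : 'D_(coord_dir R b) (Defs.iterD F s) = G by [].
by apply/funext => x; have [] := GE x.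
Qed.

Lemma iterD_near (f F : pt -> R) (D : set pt) s x : (forall y, D y -> f y = F y) ->
  interior D x -> Defs.iterD f s x = Defs.iterD F s x.
Proof.
move=> fF; elim: s x => [|b s IH] x Dx /=; first by apply: fF; exact: interior_subset Dx.
by apply: near_eq_derive; have := nbhs_interior Dx; apply: filterS => y; exact: IH.
Qed.

Lemma smooth_Cr_on n F f (D : set pt) : smooth n F -> (forall y, D y -> f y = F y) ->
  Cr_on n D f.
Proof.
move=> nF fF; split.
- apply: (@subspace_eq_continuous _ D _ F); first by move=> y yD; apply/esym/fF; exact: set_mem yD.
  exact/continuous_subspaceT/(smooth_continuous nF).
- move=> s b x sn Dx; have := smooth_iterD nF (ltnW sn).
  case E : (n - size s)%N => [|m]; first by move/eqP: E; rewrite subn_eq0 leqNgt sn.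
  move=> [_ /(_ b)[G [_ /(_ x)[dF _]]]].
  apply: near_eq_derivable dF; have := nbhs_interior Dx.
  by apply: filterS => y Dy; rewrite (iterD_near s fF Dy).
- move=> s sn; exists (Defs.iterD F s); split.
    exact/continuous_subspaceT/(smooth_continuous (smooth_iterD nF sn)).
  by move=> x Dx; rewrite (iterD_near s fF Dx).
Qed.

Lemma is_derive_line (F : pt -> R) x v k :
  is_derive (0 : R) 1 (fun t => F (x + t *: v)) k -> is_derive x v F k.
Proof.
pose g1 h := h^-1 *: ((F \o shift x) (h *: v) - F x).
pose g2 h := h^-1 *: (((fun t => F (x + t *: v)) \o shift 0) (h *: (1 : R)) - F (x + 0 *: v)).
have E : g1 = g2.
  apply/funext => h; rewrite /g1 /g2 /= [h%:A]mulr1 addr0 scale0r addr0.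
  by rewrite (addrC x).
move=> [dF vF]; split.
  by rewrite /derivable -/g1 E.
by rewrite /derive -/g1 E.
Qed.

Lemma is_derive_horner (P : {poly R}) (t : R) : is_derive t 1 (horner P) P^`().[t].
Proof.
by split; [exact: derivable_horner|rewrite -derive1E -derivE].
Qed.

Definition mono (c : R) i j (x : pt) := c * x.1 ^+ i * x.2 ^+ j.

Lemma mono_poly_le d c i j : (i + j <= d)%N -> poly_le d (mono c i j).
Proof. exact: poly_le_mono. Qed.

Lemma smooth_mono n c i j : smooth n (mono c i j).
Proof.
have mc c' i' j' : continuous (mono c' i' j').
  by apply: (@poly_le_continuous _ (i' + j')); exact: mono_poly_le.
elim: n c i j => [|n IH] c i j; split => // b; case: b.
(* For [j = 0] the exponent [j.-1] is a dummy, since the coefficient vanishes. *)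
- exists (mono (c * j%:R) i j.-1); split => // x; apply: is_derive_line.
  pose P := (c * x.1 ^+ i) *: ('X + x.2%:P) ^+ j.
  have -> : mono (c * j%:R) i j.-1 x = P^`().[0].
    rewrite /P derivZ deriv_exp derivD derivX derivC addr0 mul1r.
    by rewrite hornerZ hornerMn !hornerE /mono -mulr_natl; ring.
  apply: near_eq_is_derive (is_derive_horner P 0); near=> t.
  by rewrite /P /mono !hornerE /= /GRing.scale/= mulr0 addr0 mulr1 (addrC t).
- exists (mono (c * i%:R) i.-1 j); split => // x; apply: is_derive_line.
  pose P := (c * x.2 ^+ j) *: ('X + x.1%:P) ^+ i.
  have -> : mono (c * i%:R) i.-1 j x = P^`().[0].
    rewrite /P derivZ deriv_exp derivD derivX derivC addr0 mul1r.
    by rewrite hornerZ hornerMn !hornerE /mono -mulr_natl; ring.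
  apply: near_eq_is_derive (is_derive_horner P 0); near=> t.
  by rewrite /P /mono !hornerE /= /GRing.scale/= mulr0 addr0 mulr1 (addrC t) mulrAC.
Unshelve. all: by end_near. Qed.

Lemma maxr0_gt0 (r : R) : 0 < r -> Num.max 0 r = r.
Proof. by move/ltW/max_r. Qed.

Lemma maxr0_le0 (r : R) : r <= 0 -> Num.max 0 r = 0.
Proof. by move/max_l. Qed.

(** Only the kink [a = 0] is delicate: there the difference quotient is
    [c * k * Num.max 0 (h * k) ^+ n.+1], which tends to 0 because the exponent is still positive. *)
Lemma is_derive_max_pow (a k c : R) n :
  is_derive (0 : R) 1 (fun t => c * Num.max 0 (a + t * k) ^+ n.+2)
    (c * k * n.+2%:R * Num.max 0 a ^+ n.+1).
Proof.
have ac : a + t * k @[t --> (0 : R)] --> a.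
  rewrite -[X in _ --> X]addr0; apply: cvgD; first exact: cvg_cst.
  by rewrite -[X in _ --> X](mul0r k); apply: cvgMr_tmp; exact: cvg_id.
have [a0|a0|a0] := ltgtP 0 a.
- pose P := c *: (a%:P + k *: 'X) ^+ n.+2.
  have -> : c * k * n.+2%:R * a ^+ n.+1 = P^`().[0].
    rewrite /P derivZ deriv_exp derivD derivZ derivX derivC add0r.
    by rewrite hornerZ hornerMn !hornerE -mulr_natl/=; ring.
  apply: near_eq_is_derive (is_derive_horner P 0); near=> t.
  rewrite /P !hornerE (mulrC k) maxr0_gt0//.
  by near: t; exact: (cvgr_gt _ ac).
- rewrite expr0n mulr0.
  apply: near_eq_is_derive (is_derive_cst (0 : R) (0 : R) (1 : R)); near=> t.
  rewrite maxr0_le0 ?expr0n ?mulr0//.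
  by near: t; exact: (cvgr_le _ ac).
- rewrite -a0 expr0n mulr0.
  pose G (t : R) := c * k * Num.max 0 (t * k) ^+ n.+1.
  have Gc : G t @[t --> (0 : R)] --> (0 : R).
    rewrite -[X in _ --> X](_ : G 0 = 0); last first.
      by rewrite /G mul0r maxr0_le0// expr0n mulr0.
    apply: cvgM; first exact: cvg_cst.
    have mc : {for (0 : R), continuous (fun t : R => Num.max 0 (t * k))}.
      apply: continuous_max; first exact: cvg_cst.
      by apply: cvgM; [exact: cvg_id|exact: cvg_cst].
    by apply: (cvg_comp _ (fun t => t ^+ n.+1) mc); exact: exprn_continuous.
  set F := (fun t : R => _).
  have Fc : h^-1 *: ((F \o shift 0) (h *: (1 : R)) - F 0) @[h --> 0^'] --> (0 : R).
    apply: cvg_trans (cvg_trans (cvg_app _ (@nbhs_dnbhs _ 0)) Gc).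
    apply: near_eq_cvg; near=> h.
    have h0 : h != 0 by near: h; exact: nbhs_dnbhs_neq.
    rewrite /F /G /= [h%:A]mulr1 !add0r mul0r addr0 (maxr0_le0 (lexx 0)).
    rewrite expr0n mulr0 subr0 /GRing.scale/=.
    have [hk|hk] := ltP 0 (h * k); last by rewrite !expr0n !mulr0.
    rewrite [(h * k) ^+ n.+2]exprS; move: ((h * k) ^+ n.+1) => X.
    by field.
  by split; [apply/cvg_ex; exists 0|exact/cvg_lim].
Unshelve. all: by end_near. Qed.

(** Each derivative lowers the exponent by one and contributes a constant, absorbed in [c]; hence
    the [d]-th truncated power has smoothness [d - 1]. *)
Lemma smooth_max_pow n c k (m : R * R * R) : (n < k)%N ->
  smooth n (fun x => c * Num.max 0 (aff m x) ^+ k).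
Proof.
have cont c' k' : continuous (fun x => c' * Num.max 0 (aff m x) ^+ k').
  by move=> x; apply: cvgM; [exact: cvg_cst|exact: (@tpow_continuous R k' m x)].
elim: n c k => [|n IH] c k nk; split => // b.
case: k nk => [//|[//|k]] nk.
exists (fun x => c * lin m (coord_dir R b) * k.+2%:R * Num.max 0 (aff m x) ^+ k.+1).
split; first exact: IH.
move=> x; apply: is_derive_line.
have := is_derive_max_pow (aff m x) (lin m (coord_dir R b)) c k.
by apply: near_eq_is_derive; near=> t; rewrite aff_lin.
Unshelve. all: by end_near. Qed.

End Membership.

Section Dimension.
Variable R : realType.
Notation pt := (R * R)%type.

Lemma has_dim_fin (S : set (pt -> R)) (I : finType) (b : I -> pt -> R) N : #|I| = N ->
  (forall i, S (b i)) ->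
  (forall c : I -> R, (forall x, \sum_i c i * b i x = 0) -> forall i, c i = 0) ->
  (forall f, S f -> exists c : I -> R, forall x, f x = \sum_i c i * b i x) ->
  has_dim S N.
Proof.
move=> <- Sb free gen; exists (fun k => b (enum_val k)); split.
- by move=> k; exact: Sb.
- move=> c c0 k; rewrite -[k]enum_valK.
  apply: (free (fun i => c (enum_rank i))) => x.
  rewrite -[RHS](congr1 (fun g => g x) c0) (reindex (@enum_rank I)).
    by apply: eq_bigr => i _; rewrite enum_rankK.
  by exists enum_val => ? _; [exact: enum_rankK|exact: enum_valK].
- move=> f /gen[c fc]; exists (fun k => c (enum_val k)); apply/funext => x.
  rewrite fc (reindex (@enum_val I xpredT)) //.
  by exists enum_rank => ? _; [exact: enum_valK|exact: enum_rankK].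
Qed.

Variable d : nat.

Definition mono_idx : finType := {ij : 'I_d.+1 * 'I_d.+1 | (ij.1 + ij.2 <= d)%N}.

Lemma card_mono_idx : #|mono_idx| = 'C(d + 2, 2).
Proof.
rewrite card_sig -sum1_card.
rewrite -(pair_big_dep xpredT (fun i j : 'I_d.+1 => (i + j <= d)%N) (fun _ _ => 1%N))/=.
(* Row [i] contributes [d + 1 - i] monomials; read backwards the sum is triangular. *)
transitivity (\sum_(i < d.+1) (d.+1 - i))%N.
  apply: eq_bigr => i _.
  rewrite -[RHS]card_ord -sum1_card (big_ord_widen d.+1 (fun _ => 1%N) (leq_subr i d.+1)).
  by apply: eq_bigl => j; rewrite ltn_subRL ltnS.
rewrite addn2 -bin2_sum big_mkord [RHS]big_ord_recl add0n (reindex_inj rev_ord_inj)/=.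
by apply: eq_bigr => i _; rewrite subKn.
Qed.

(** One variable at a time: for fixed second coordinate [y] each coefficient in the first vanishes,
    and this coefficient is a polynomial in [y] with coefficients from [a]. *)
Lemma mono_free (a : mono_idx -> R) :
  (forall x : pt, \sum_u a u * mono 1 (val u).1 (val u).2 x = 0) -> forall u, a u = 0.
Proof.
move=> H u0.
have poly0 (P : {poly R}) : (forall t, P.[t] = 0) -> P = 0.
  by move=> P0; apply: poly_near_right0; near=> t.
have E1 y k : \sum_u a u * y ^+ (val u).2 * (k == (val u).1)%:R = 0.
  pose P := \sum_u (a u * y ^+ (val u).2) *: 'X^((val u).1).
  have -> : \sum_u a u * y ^+ (val u).2 * (k == (val u).1)%:R = P`_k.
    by rewrite coef_sum; apply: eq_bigr => u _; rewrite coefZ coefXn.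
  rewrite (poly0 P) ?coef0// => t; rewrite -[RHS](H (t, y)) horner_sum.
  apply: eq_bigr => u _; rewrite hornerZ hornerXn /mono mul1r /=.
  by rewrite -mulrA [X in _ * X]mulrC.
have E2 k l : \sum_u a u * (k == (val u).1)%:R * (l == (val u).2)%:R = 0.
  pose P := \sum_u (a u * (k == (val u).1)%:R) *: 'X^((val u).2).
  have -> : \sum_u a u * (k == (val u).1)%:R * (l == (val u).2)%:R = P`_l.
    by rewrite coef_sum; apply: eq_bigr => u _; rewrite coefZ coefXn.
  rewrite (poly0 P) ?coef0// => t; rewrite -[RHS](E1 t k) horner_sum.
  by apply: eq_bigr => u _; rewrite hornerZ hornerXn mulrAC.
have := E2 (val u0).1 (val u0).2.
rewrite (bigD1 u0)//= !eqxx !mulr1 big1 ?addr0// => u uu0.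
case: eqP => [e1|_]; last by rewrite mulr0 mul0r.
case: eqP => [e2|_]; last by rewrite mulr0.
case/eqP: uu0; apply/val_inj; rewrite [LHS]surjective_pairing [RHS]surjective_pairing.
by congr (_, _); exact/esym.
Unshelve. all: by end_near. Qed.

Lemma poly_le_mono_span (q : pt -> R) : poly_le d q ->
  exists a : mono_idx -> R, forall x, q x = \sum_u a u * mono 1 (val u).1 (val u).2 x.
Proof.
move=> [c qc].
pose C (i j : 'I_d.+1) (u : mono_idx) : R := if val u == (i, j) then c i j else 0.
exists (fun u => \sum_(i < d.+1) \sum_(j < d.+1 | (i + j <= d)%N) C i j u) => x.
rewrite qc; under [RHS]eq_bigr do rewrite mulr_suml.
rewrite exchange_big/=; apply: eq_bigr => i _.
under [RHS]eq_bigr do rewrite mulr_suml.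
rewrite exchange_big/=; apply: eq_bigr => j ij.
pose u0 : mono_idx := exist _ (i, j) ij.
rewrite (bigD1 u0)//= big1 ?addr0 => [|u uu0].
  by rewrite /C /= eqxx /mono mul1r mulrA.
rewrite /C; case: eqP => [e|_]; last by rewrite mul0r.
by case/eqP: uu0; exact/val_inj.
Qed.

Lemma mono_comb_poly_le (a : mono_idx -> R) :
  poly_le d (fun x : pt => \sum_u a u * mono 1 (val u).1 (val u).2 x).
Proof.
by apply: poly_le_sum => u; apply/poly_leZ/mono_poly_le; exact: (valP u).
Qed.

Variables (p1 p2 p3 : pt) (nondeg : nondegenerate_triangle p1 p2 p3).
Hypothesis d_gt0 : (0 < d)%N.
Notation T := (triangle p1 p2 p3).
Notation chords := (@chords R p1 p2 p3 d).

Definition zero_ext (F : pt -> R) (x : pt) : R := if `[< T x >] then F x else 0.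

Lemma zero_extT F x : T x -> zero_ext F x = F x.
Proof. by rewrite /zero_ext; case: asboolP. Qed.

Lemma zero_extN F x : ~ T x -> zero_ext F x = 0.
Proof. by rewrite /zero_ext; case: asboolP. Qed.

Lemma zero_ext_spline F : smooth (d - 1) F ->
  (forall P, ws_polygons p1 p2 p3 d P -> exists g, poly_le d g /\ forall x, P x -> F x = g x) ->
  ws_spline_space p1 p2 p3 d (zero_ext F).
Proof.
move=> sF pF; split; first exact: zero_extN.
  by apply: (smooth_Cr_on sF) => y; exact: zero_extT.
move=> P Pp; have [g [pg Fg]] := pF P Pp; exists g; split => // x Px.
by rewrite zero_extT ?Fg//; exact: (polygon_triangle nondeg Pp).
Qed.

Definition basis (k : mono_idx + idx d) : pt -> R := zero_ext
  (match k with inl u => mono 1 (val u).1 (val u).2 | inr i => tpow d (chords i) end).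

Lemma basis_spline k : ws_spline_space p1 p2 p3 d (basis k).
Proof.
case: k => [u|i]; apply: zero_ext_spline.
- exact: smooth_mono.
- move=> P _; exists (mono 1 (val u).1 (val u).2); split => //.
  by apply/mono_poly_le; exact: (valP u).
- have := @smooth_max_pow R (d - 1) 1 d (chords i).
  rewrite (_ : (fun x => _) = tpow d (chords i)); last first.
    by apply/funext => x; rewrite mul1r.
  by apply; rewrite subn1 prednK.
- move=> P Pp; have [Pi|Pi] := polygon_sign nondeg d_gt0 i Pp.
    exists (fun x => aff (chords i) x ^+ d); split; first exact: poly_le_affX.
    by move=> x /Pi; exact: tpow_ge0.
  exists (fun=> 0); split; first exact: poly_le0.
  by move=> x /Pi; exact: tpow_le0.
Qed.

Lemma sum_basis (c : mono_idx + idx d -> R) x : T x -> \sum_k c k * basis k x =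
  \sum_u c (inl u) * mono 1 (val u).1 (val u).2 x + tpow_comb d chords (fun i => c (inr i)) x.
Proof.
move=> Tx; rewrite big_sumType/=; congr (_ + _);
by apply: eq_bigr => k _; rewrite /basis zero_extT.
Qed.

Lemma basis_free (c : mono_idx + idx d -> R) :
  (forall x, \sum_k c k * basis k x = 0) -> forall k, c k = 0.
Proof.
move=> H.
have near0 z : inner p1 p2 p3 z -> \forall y \near z,
   \sum_u c (inl u) * mono 1 (val u).1 (val u).2 y + tpow_comb d chords (fun i => c (inr i)) y = 0.
  move=> Uz; have : \forall y \near z, inner p1 p2 p3 y.
    by apply: open_nbhs_nbhs; split => //; exact: open_inner.
  by apply: filterS => y Uy; rewrite -sum_basis//; exact: inner_triangle.
have c0 i : c (inr i) = 0.
  (* The midpoint of chord [i] is interior, so the vanishing sum is known on a full neighbourhood of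
     a point of this line. *)
  have Uz := lam_mid nondeg d_gt0 i.1.1 (ltn_ord i.1.2) (ltn_ord i.2).
  set z := _ + _ in Uz.
  apply: (tpow_comb_coef0 d_gt0 (chords_indep nondeg d_gt0) (@chords_nondeg _ _ _ _ nondeg d)
    (c := fun i => c (inr i)) (mono_comb_poly_le (fun u => c (inl u))) (z := z)).
    have [h1 h2] := chord_edge nondeg d_gt0 i.1.1 (ltn_ord i.1.2) (ltn_ord i.2).
    by rewrite /z aff_seg -/(chords i) h1 h2 !mulr0 addr0.
  exact: near0.
move=> [u|//]; apply: (mono_free (a := fun u => c (inl u))).
have [z Uz] := inner_nonempty nondeg.
apply: (poly_le_id (mono_comb_poly_le (fun u => c (inl u))) (x := z)).
have := near0 z Uz; apply: filterS => y.
by rewrite [X in _ + X]big1 ?addr0// => i _; rewrite c0 mul0r.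
Qed.

Lemma basis_span f :
  (forall x : pt, ws_interior_vertex p1 p2 p3 d x -> (ws_lines_through p1 p2 p3 d x <= d.+1)%N) ->
  ws_spline_space p1 p2 p3 d f ->
  exists c : mono_idx + idx d -> R, forall x, f x = \sum_k c k * basis k x.
Proof.
move=> H fS; have [c [q [pq fq]]] := spline_rep_triangle nondeg d_gt0 fS H.
have [a qa] := poly_le_mono_span pq.
exists (fun k => match k with inl u => a u | inr i => c i end) => x.
have [Tx|Tx] := pselect (T x); first by rewrite sum_basis// fq// qa.
have [f0 _ _] := fS; rewrite f0// big1// => k _.
by rewrite /basis zero_extN// mulr0.
Qed.

End Dimension.

Theorem theorem2p2 (R : realType) (d : nat) (p1 p2 p3 : R * R) :
  (1 <= d)%N ->
  nondegenerate_triangle p1 p2 p3 ->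
  (forall x : R * R, ws_interior_vertex p1 p2 p3 d x ->
     (ws_lines_through p1 p2 p3 d x <= d.+1)%N) ->
  has_dim (ws_spline_space p1 p2 p3 d) ('C(d + 2, 2) + 3 * d * (d - 1))%N.
Proof.
move=> d_gt0 nondeg H; apply: (has_dim_fin (b := @basis R d p1 p2 p3)).
- by rewrite card_sum card_mono_idx !card_prod !card_ord subn1.
- by move=> k; exact: basis_spline.
- exact: basis_free.
- by move=> f; exact: basis_span.
Qed.
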